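(* (Second Cartan structure equation.) Let $H$ be a triangular Hopf algebra, $A$ a braided commutative left $H$-module algebra, and let $\mathfrak X(A)$, $\Omega(A)$ and the symmetric $H$-equivariant $A$-bimodule $\Gamma$ be finitely generated and projective as $A$-modules. Let $\nabla:\Gamma\to\Omega(A)\otimes_A\Gamma$ be a left connection with curvature $R_\nabla$ and dual right connection ${}^*\nabla:{}^*\Gamma\to{}^*\Gamma\otimes_A\Omega(A)$. Then for all $u,v\in\mathfrak X(A)$, $s\in\Gamma$, $\sigma\in{}^*\Gamma$, $$\langle R_\nabla(u,v,s),\sigma\rangle=\langle u\otimes_Av\otimes_As,\ \mathrm d_{{}^*\nabla}^{\,2}\,\sigma\rangle,$$ or, equivalently, $\langle R_\nabla(u,v,s),\sigma\rangle=\frac12\langle u\wedge v\otimes_As,\ \mathrm d_{{}^*\nabla}^{\,2}\,\sigma\rangle$.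
   Context: $\Bbbk$ is a field of characteristic zero, or the ring of formal power series over such a field; $\otimes$ is over $\Bbbk$; algebras are associative and unital; Hopf algebras have invertible antipode $S$; $\Delta(h)=h_{(1)}\otimes h_{(2)}$. $H$ is triangular with universal R-matrix $\mathcal R$ ($\Delta^{cop}(h)=\mathcal R\Delta(h)\mathcal R^{-1}$, $(\Delta\otimes\mathrm{id})\mathcal R=\mathcal R_{13}\mathcal R_{23}$, $(\mathrm{id}\otimes\Delta)\mathcal R=\mathcal R_{13}\mathcal R_{12}$, $\mathcal R_{21}=\mathcal R^{-1}$); write $\mathcal R^{-1}=\bar R^\alpha\otimes\bar R_\alpha$, summation understood. Modules. $A$ is a left $H$-module algebra, braided commutative: $ab=(\bar R^\alpha\triangleright b)(\bar R_\alpha\triangleright a)$. An $H$-equivariant $A$-bimodule is an $A$-bimodule with compatible $H$-action; it is symmetric if $av=(\bar R^\alpha\triangleright v)(\bar R_\alpha\triangleright a)$. Tensor products carry the diagonal $H$-action; the braiding is $\tau(v\otimes_A w)=\bar R^\alpha\triangleright w\otimes_A\bar R_\alpha\triangleright v$. For such $\Gamma$, ${}^*\Gamma={}_A\mathrm{hom}(\Gamma,A)$ is the module of left $A$-linear maps, $\langle s,\sigma\rangle:=\sigma(s)$, with $(\sigma a)(s)=\sigma(s)a$, $(a\sigma)(s)=\sigma(sa)$, $(h\triangleright\sigma)(s)=h_{(2)}\triangleright\sigma(S^{-1}(h_{(1)})\triangleright s)$. Vector fields. $\mathfrak X(A)$ is the set of braided derivations: $\Bbbk$-linear $u:A\to A$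 with $u(ab)=u(a)b+(\bar R^\alpha\triangleright a)(\bar R_\alpha\triangleright u)(b)$, where $(h\triangleright u)(a)=h_{(1)}\triangleright(u(S(h_{(2)})\triangleright a))$; bimodule structure $(au)(b)=a\,u(b)$, $ua=(\bar R^\alpha\triangleright a)(\bar R_\alpha\triangleright u)$; bracket $[u,v]=u\circ v-(\bar R^\alpha\triangleright v)\circ(\bar R_\alpha\triangleright u)$; $u\wedge v=u\otimes_Av-\bar R^\alpha\triangleright v\otimes_A\bar R_\alpha\triangleright u$. Forms. $\mathrm d:A\to{}^*\mathfrak X(A)$, $\langle u,\mathrm da\rangle=u(a)$; $\Omega(A):=A\,\mathrm dA$ (under the projectivity assumption $\Omega(A)={}^*\mathfrak X(A)$). $\Omega^r(A)\subset\Omega(A)^{\otimes_Ar}$ is the image of $A_r=\frac1{r!}\sum_\wp\mathrm{sign}(\wp)\Pi_\wp$, with $\Pi$ the representation of the permutation group generated by $\tau$ on adjacent factors; $\theta\wedge\theta'=\frac{(r+r')!}{r!r'!}A_{r+r'}(\theta\otimes_A\theta')$ for $\theta\in\Omega^r(A),\theta'\in\Omega^{r'}(A)$; $\mathrm d$ extends uniquely to an $H$-equivariant degree-one map on $\Omega^\bullet(A)$ with $\mathrm d^2=0$ and the graded Leibniz rule. Connections. A left connection on $\Gamma$ is a $\Bbbk$-linear $\nabla:\Gamma\to\Omega(A)\otimes_A\Gamma$ with $\nabla(as)=\mathrm da\otimes_As+a\nabla(s)$. Put $\nabla_us=\mathrm i_u(\nabla s)$ with $\mathrm i_u(\theta\otimes_As)=\langle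 u,\theta\rangle s$, and $R_\nabla(u,v,s)=\nabla_u\nabla_vs-\nabla_{\bar R^\alpha\triangleright v}\nabla_{\bar R_\alpha\triangleright u}s-\nabla_{[u,v]}s$. The dual right connection ${}^*\nabla$ is defined by $\mathrm d\langle s,\sigma\rangle=\langle\nabla s,\sigma\rangle+\langle s,{}^*\nabla\sigma\rangle$, where $\langle\theta\otimes_As,\sigma\otimes_A\eta\rangle=\theta\wedge\langle s,\sigma\rangle\wedge\eta$; it satisfies ${}^*\nabla(\sigma a)={}^*\nabla(\sigma)a+\sigma\otimes_A\mathrm da$ and extends to ${}^*\Gamma\otimes_A\Omega^\bullet(A)$ by $\mathrm d_{{}^*\nabla}(\sigma\otimes_A\theta)={}^*\nabla(\sigma)\wedge\theta+\sigma\otimes_A\mathrm d\theta$; $\mathrm d_{{}^*\nabla}^{\,2}=\mathrm d_{{}^*\nabla}\circ\mathrm d_{{}^*\nabla}$. The pairing of $\mathfrak X(A)\otimes_A\mathfrak X(A)\otimes_A\Gamma$ with ${}^*\Gamma\otimes_A\Omega(A)\otimes_A\Omega(A)$ (containing ${}^*\Gamma\otimes_A\Omega^2(A)$) is $\langle u\otimes_Av\otimes_As,\sigma\otimes_A\theta_1\otimes_A\theta_2\rangle=\langle u,\langle v,\langle s,\sigma\rangle\theta_1\rangle\theta_2\rangle$. *)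

(* Defs.v *)
From HB Require Import structures.
From mathcomp Require Import all_boot all_order all_algebra.
From mathcomp Require Import boolp functions.

Set Implicit Arguments.
Unset Strict Implicit.
Unset Printing Implicit Defensive.
Import GRing.Theory.
Local Open Scope ring_scope.
Local Open Scope quotient_scope.

(* The tensor product of M and N balanced over a set S of scalars acting on M
   from the right (r) and on N from the left (l): formal sums of pairs, two of
   them being identified when no balanced biadditive map into an abelian group
   separates them. Its universal property is tfold_tmk, tfoldD and tens_gen. *)
Section BalancedTensor.
Variables (S : Type) (M N : zmodType) (r : M -> S -> M) (l : S -> N -> N).

Definition balanced (P : zmodType) (f : M -> N -> P) : Prop :=
  [/\ forall n, {morph f^~ n : m m' / m + m'},
      forall m, {morph f m : n n' / n + n'}
    & forall m s n, f (r m s) n = f m (l s n)].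

Definition fsum (P : zmodType) (f : M -> N -> P) (z : seq (M * N)) : P :=
  \sum_(p <- z) f p.1 p.2.

Definition tens_rel (z z' : seq (M * N)) : bool :=
  `[< forall (P : zmodType) (f : M -> N -> P),
        balanced f -> fsum f z = fsum f z' >].

Lemma tens_rel_equiv : equiv_class_of tens_rel.
Proof.
split.
- by move=> z; apply/asboolP.
- by move=> z z'; apply/asboolP/asboolP => h P f hf; rewrite h.
- by move=> z2 z1 z3 /asboolP h1 /asboolP h2; apply/asboolP => P f hf; rewrite h1 ?h2.
Qed.

Canonical tens_equiv := EquivRelPack tens_rel_equiv.

Definition tens : Type := {eq_quot tens_equiv}.
HB.instance Definition _ := Choice.on tens.
HB.instance Definition _ := EqQuotient.on tens.

(* tfold f t is the sum of the f m n over a chosen presentation of t as a sum of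
   pure tensors m ⊗ n; for balanced f it does not depend on the presentation
   (tfold_pi), and every use in a definition below is balanced. *)
Definition tfold (P : zmodType) (f : M -> N -> P) (t : tens) : P :=
  fsum f (repr t).

Lemma tfold_pi (P : zmodType) (f : M -> N -> P) (z : seq (M * N)) :
  balanced f -> tfold f (\pi_tens z) = fsum f z.
Proof.
move=> hf; rewrite /tfold.
have /eqmodP/asboolP h : repr (\pi_tens z) = z %[mod tens] by rewrite reprK.
exact: h.
Qed.

Lemma tens_eq (z z' : seq (M * N)) :
  (forall (P : zmodType) (f : M -> N -> P), balanced f -> fsum f z = fsum f z') ->
  \pi_tens z = \pi_tens z'.
Proof. by move=> h; apply/eqmodP/asboolP. Qed.

Definition tadd (t u : tens) : tens := \pi_tens (repr t ++ repr u).
Definition topp (t : tens) : tens := \pi_tens [seq (- p.1, p.2) | p <- repr t].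
Definition tzero : tens := \pi_tens [::].
Definition tmk (m : M) (n : N) : tens := \pi_tens [:: (m, n)].

Lemma tfold_add (P : zmodType) (f : M -> N -> P) t u : balanced f ->
  tfold f (tadd t u) = tfold f t + tfold f u.
Proof. by move=> hf; rewrite tfold_pi // /fsum big_cat. Qed.

Lemma balN (P : zmodType) (f : M -> N -> P) m n : balanced f -> f (- m) n = - f m n.
Proof.
case=> h1 _ _.
have h0 : f 0 n = 0 by apply: (addrI (f 0 n)); rewrite -h1 !addr0.
by apply: (addrI (f m n)); rewrite -h1 !subrr.
Qed.

Lemma tfold_opp (P : zmodType) (f : M -> N -> P) t : balanced f -> tfold f (topp t) = - tfold f t.
Proof.
move=> hf; rewrite tfold_pi // /fsum big_map /tfold /fsum -sumrN.
by apply: eq_bigr => p _; rewrite (balN _ _ hf).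
Qed.

Lemma tfold_zero (P : zmodType) (f : M -> N -> P) : balanced f -> tfold f tzero = 0.
Proof. by move=> hf; rewrite tfold_pi // /fsum big_nil. Qed.

Lemma tens_ext (t u : tens) :
  (forall (P : zmodType) (f : M -> N -> P), balanced f -> tfold f t = tfold f u) ->
  t = u.
Proof. by move=> h; rewrite -[t]reprK -[u]reprK; apply: tens_eq. Qed.

Fact taddA : associative tadd.
Proof. by move=> t u v; apply: tens_ext => P f hf; rewrite !tfold_add // addrA. Qed.
Fact taddC : commutative tadd.
Proof. by move=> t u; apply: tens_ext => P f hf; rewrite !tfold_add // addrC. Qed.
Fact tadd0 : left_id tzero tadd.
Proof. by move=> t; apply: tens_ext => P f hf; rewrite tfold_add // tfold_zero // add0r. Qed.
Fact taddN : left_inverse tzero topp tadd.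
Proof.
by move=> t; apply: tens_ext => P f hf; rewrite tfold_add // tfold_opp // tfold_zero // addNr.
Qed.
HB.instance Definition _ := GRing.isZmodule.Build tens taddA taddC tadd0 taddN.

Lemma tfoldD (P : zmodType) (f : M -> N -> P) : balanced f -> {morph tfold f : t u / t + u}.
Proof. by move=> hf t u; apply: tfold_add. Qed.

Lemma tfold_tmk (P : zmodType) (f : M -> N -> P) m n : balanced f -> tfold f (tmk m n) = f m n.
Proof. by move=> hf; rewrite tfold_pi // /fsum big_seq1. Qed.

Lemma tmk_balanced : balanced tmk.
Proof.
split=> [n m m'|m n n'|m s n]; apply: tens_ext => P f hf; have [h1 h2 h3] := hf;
by rewrite ?tfold_add // !tfold_pi // /fsum !big_seq1 /= ?h1 ?h2 ?h3.
Qed.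


Lemma tfold_comp (P Q : zmodType) (g : P -> Q) (f : M -> N -> P) t :
  {morph g : x y / x + y} -> g (tfold f t) = tfold (fun m n => g (f m n)) t.
Proof.
move=> h; apply: big_morph => //.
by apply: (addrI (g 0)); rewrite -h !addr0.
Qed.

Lemma eq_tfold (P : zmodType) (f g : M -> N -> P) t : f =2 g -> tfold f t = tfold g t.
Proof. by move=> h; apply: eq_bigr => p _; apply: h. Qed.

Lemma tens_gen (t : tens) : tfold tmk t = t.
Proof.
apply: tens_ext => P f hf; rewrite (tfold_comp _ _ (tfoldD hf)).
by apply: eq_tfold => m n; rewrite tfold_tmk.
Qed.

End BalancedTensor.
Arguments tmk {S M N r l}.
Arguments tfold {S M N r l P}.





Section TensorOverBase.
Variables (k : comUnitRingType) (M N : lmodType k).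
Definition ktens : Type :=
  tens (fun (m : M) (c : k) => c *: m) (fun (c : k) (n : N) => c *: n).
HB.instance Definition _ := GRing.Zmodule.on ktens.
Implicit Types (t : ktens) (P : zmodType).
Definition ktmk (m : M) (n : N) : ktens := tmk m n.
Definition kfold P (f : M -> N -> P) t : P := tfold f t.
Definition kscale (c : k) t : ktens := kfold (fun m n => ktmk (c *: m) n) t.

Definition kbalanced P (f : M -> N -> P) : Prop :=
  balanced (fun (m : M) (c : k) => c *: m) (fun (c : k) (n : N) => c *: n) f.

Lemma kfoldD P (f : M -> N -> P) : kbalanced f -> {morph kfold f : t u / t + u}.
Proof. exact: tfoldD. Qed.

Lemma kfold_tmk P (f : M -> N -> P) m n : kbalanced f -> kfold f (ktmk m n) = f m n.
Proof. exact: tfold_tmk. Qed.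

Lemma kfold_comp (P Q : zmodType) (g : P -> Q) (f : M -> N -> P) t :
  {morph g : x y / x + y} -> g (kfold f t) = kfold (fun m n => g (f m n)) t.
Proof. exact: tfold_comp. Qed.

Lemma kfold_kfold (f : M -> N -> ktens) P (g : M -> N -> P) t : kbalanced g ->
  kfold g (kfold f t) = kfold (fun m n => kfold g (f m n)) t.
Proof. by move=> hg; apply: kfold_comp; apply: kfoldD. Qed.

Lemma ktens_ext t u :
  (forall P (f : M -> N -> P), kbalanced f -> kfold f t = kfold f u) -> t = u.
Proof. exact: tens_ext. Qed.

Lemma eq_kfold P (f g : M -> N -> P) t : f =2 g -> kfold f t = kfold g t.
Proof. by move=> h; apply: eq_bigr => p _; apply: h. Qed.

Lemma kfold_scale P (f : M -> N -> P) c t : kbalanced f ->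
  kfold f (kscale c t) = kfold (fun m n => f (c *: m) n) t.
Proof.
by move=> hf; rewrite kfold_kfold //; apply: eq_kfold => m n; rewrite kfold_tmk.
Qed.

Lemma kbal_scale P (f : M -> N -> P) c : kbalanced f -> kbalanced (fun m n => f (c *: m) n).
Proof.
case=> h1 h2 h3; split=> [n m m'|m n n'|m d n].
- by rewrite /= scalerDr h1.
- by rewrite h2.
- by rewrite -h3 !scalerA mulrC.
Qed.

Fact kscaleA a b t : kscale a (kscale b t) = kscale (a * b) t.
Proof.
apply: ktens_ext => P f hf; rewrite !kfold_scale //; last exact: kbal_scale.
by apply: eq_kfold => m n; rewrite scalerA mulrC.
Qed.
Fact kscale1 : left_id 1 kscale.
Proof.
move=> t; apply: ktens_ext => P f hf; rewrite !kfold_scale //.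
by apply: eq_kfold => m n; rewrite scale1r.
Qed.
Fact kscaleDr : right_distributive kscale +%R.
Proof.
move=> c t u; apply: ktens_ext => P f hf.
by rewrite kfoldD // !kfold_scale // kfoldD //; apply: kbal_scale.
Qed.
Fact kscaleDl t : {morph kscale^~ t : a b / a + b}.
Proof.
move=> a b; apply: ktens_ext => P f hf.
rewrite kfoldD // !kfold_scale //= -big_split; apply: eq_bigr => p _ /=.
by case: hf => h1 _ _; rewrite scalerDl h1.
Qed.
HB.instance Definition _ :=
  GRing.Zmodule_isLmodule.Build k ktens kscaleA kscale1 kscaleDr kscaleDl.

End TensorOverBase.
Arguments kbalanced {k M N P}.
Arguments ktmk {k M N}.
Arguments kfold {k M N P}.

Section Bilinear.
Variables (k : comUnitRingType) (M N : lmodType k).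

Definition bilin (P : lmodType k) (f : M -> N -> P) : Prop :=
  (forall n, linear (f^~ n)) /\ (forall m, linear (f m)).

Lemma linD (U V : lmodType k) (f : U -> V) : linear f -> {morph f : x y / x + y}.
Proof. by move=> h x y; rewrite -[x]scale1r h !scale1r. Qed.
Lemma lin0 (U V : lmodType k) (f : U -> V) : linear f -> f 0 = 0.
Proof. by move=> h; apply: (addrI (f 0)); rewrite -linD // !addr0. Qed.
Lemma linZ (U V : lmodType k) (f : U -> V) : linear f -> forall c x, f (c *: x) = c *: f x.
Proof. by move=> h c x; rewrite -[c *: x]addr0 h lin0 // addr0. Qed.

Lemma bilin_bal (P : lmodType k) (f : M -> N -> P) : bilin f -> kbalanced f.
Proof.
case=> h1 h2; split=> [n|m|m c n]; try exact: linD.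
by rewrite (linZ (h2 _)) (linZ (h1 n)).
Qed.

Lemma kfold_lin (P : lmodType k) (f : M -> N -> P) : bilin f -> linear (kfold f).
Proof.
move=> h c t u; have hb := bilin_bal h; rewrite kfoldD // kfold_scale //; congr (_ + _).
by rewrite /kfold /tfold /fsum scaler_sumr; apply: eq_bigr => p _; rewrite (linZ (h.1 _)).
Qed.

Lemma kfold_par (P : lmodType k) (F G K : M -> N -> P) c t :
  (forall m n, F m n = c *: G m n + K m n) -> kfold F t = c *: kfold G t + kfold K t.
Proof.
move=> h; rewrite /kfold /tfold /fsum scaler_sumr -big_split.
by apply: eq_bigr => p _; rewrite h.
Qed.

Lemma ktmk_bilin : bilin (@ktmk k M N).
Proof.
have [h1 h2 h3] : kbalanced (@ktmk k M N) by exact: tmk_balanced.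
have hs m n c : c *: ktmk m n = ktmk (c *: m) n :> ktens M N.
  by apply: kfold_tmk; apply: (kbal_scale c); split.
by split=> [n|m] c x y; rewrite hs ?h1 // h3 h2.
Qed.

End Bilinear.

Reserved Notation "\ksum_ ( x , y <- t ) F"
  (at level 36, x, y at level 1, t at level 100, F at level 36,
   format "'[' \ksum_ ( x ,  y  <-  t ) '/  '  F ']'").
(* Sweedler notation: \ksum_(x, y <- comul h) F x y stands for F h_(1) h_(2), and
   \ksum_(x, y <- univRV) F x y for the sum of the F Rbar^alpha Rbar_alpha. *)
Notation "\ksum_ ( x , y <- t ) F" := (kfold (fun x y => F) t) : ring_scope.
Notation "x ⊗ y" := (ktmk x y) (at level 38, no associativity) : ring_scope.

Section TensorProductAlgebra.
Variables (k : comUnitRingType) (A : algType k).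

Definition kmul2 (t u : ktens A A) : ktens A A :=
  \ksum_(a, b <- t) \ksum_(c, d <- u) ((a * c) ⊗ (b * d)).
Definition kmul3 (t u : ktens A (ktens A A)) : ktens A (ktens A A) :=
  \ksum_(a, b <- t) \ksum_(c, d <- u) ((a * c) ⊗ (kmul2 b d)).
Definition kswap (t : ktens A A) : ktens A A := \ksum_(a, b <- t) (b ⊗ a).
Definition leg12 (t : ktens A A) : ktens A (ktens A A) := \ksum_(a, b <- t) (a ⊗ (b ⊗ 1)).
Definition leg13 (t : ktens A A) : ktens A (ktens A A) := \ksum_(a, b <- t) (a ⊗ (1 ⊗ b)).
Definition leg23 (t : ktens A A) : ktens A (ktens A A) := \ksum_(a, b <- t) (1 ⊗ (a ⊗ b)).

End TensorProductAlgebra.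


HB.mixin Record Algebra_isHopf (k : comUnitRingType) H of GRing.Algebra k H := {
  comul : {linear H -> ktens H H};
  counit : {scalar H};
  antipode : {linear H -> H};
  antipodeV : H -> H;
  comul1 : comul 1 = 1 ⊗ 1;
  comulM : forall g h, comul (g * h) = kmul2 (comul g) (comul h);
  counit1 : counit 1 = 1;
  counitM : forall g h, counit (g * h) = counit g * counit h;
  comulA : forall h,
    \ksum_(x, y <- comul h) \ksum_(x1, x2 <- comul x) (x1 ⊗ (x2 ⊗ y))
    = \ksum_(x, y <- comul h) (x ⊗ comul y);
  counitl : forall h, \ksum_(x, y <- comul h) (counit x *: y) = h;
  counitr : forall h, \ksum_(x, y <- comul h) (counit y *: x) = h;
  antipodel : forall h, \ksum_(x, y <- comul h) (antipode x * y) = (counit h)%:A;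
  antipoder : forall h, \ksum_(x, y <- comul h) (x * antipode y) = (counit h)%:A;
  antipodeK : cancel antipode antipodeV;
  antipodeVK : cancel antipodeV antipode
}.
#[short(type="hopfAlgType")]
HB.structure Definition HopfAlgebra (k : comUnitRingType) :=
  { H of GRing.Algebra k H & Algebra_isHopf k H }.

(* univRV is the inverse of the universal R-matrix univR. *)
HB.mixin Record Hopf_isTriangular (k : comUnitRingType) H of HopfAlgebra k H := {
  univR : ktens H H;
  univRV : ktens H H;
  univRK : kmul2 univR univRV = 1 ⊗ 1;
  univRVK : kmul2 univRV univR = 1 ⊗ 1;
  quasi_cocommutative : forall h : H,
    kswap (comul h) = kmul2 (kmul2 univR (comul h)) univRV;
  univR_comull :
    \ksum_(x, y <- univR) \ksum_(x1, x2 <- comul x) (x1 ⊗ (x2 ⊗ y))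
    = kmul3 (leg13 univR) (leg23 univR);
  univR_comulr :
    \ksum_(x, y <- univR) (x ⊗ comul y)
    = kmul3 (leg13 univR) (leg12 univR);
  univR_triangular : kswap univR = univRV
}.
#[short(type="triangularHopfAlgType")]
HB.structure Definition TriangularHopfAlgebra (k : comUnitRingType) :=
  { H of HopfAlgebra k H & Hopf_isTriangular k H }.

HB.mixin Record Algebra_isHopfModule (k : comUnitRingType) (H : hopfAlgType k) A
    of GRing.Algebra k A := {
  act : H -> A -> A;
  act_linl : forall a, linear (act^~ a);
  act_linr : forall h, linear (act h);
  act1l : forall a, act 1 a = a;
  actMl : forall g h a, act (g * h) a = act g (act h a);
  act1r : forall h, act h 1 = (counit h)%:A;
  actMr : forall h a b, act h (a * b) = \ksum_(x, y <- comul h) (act x a * act y b)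
}.
#[short(type="hopfModuleAlgType")]
HB.structure Definition HopfModuleAlgebra (k : comUnitRingType) (H : hopfAlgType k) :=
  { A of GRing.Algebra k A & Algebra_isHopfModule k H A }.

HB.mixin Record HopfModuleAlgebra_isBraidedCommutative (k : comUnitRingType)
    (H : triangularHopfAlgType k) A of HopfModuleAlgebra k H A := {
  braided_mulC : forall a b : A,
    a * b = \ksum_(x, y <- (univRV : ktens H H)) (act x b * act y a)
}.
#[short(type="braidedComAlgType")]
HB.structure Definition BraidedComAlgebra (k : comUnitRingType) (H : triangularHopfAlgType k) :=
  { A of HopfModuleAlgebra k H A & HopfModuleAlgebra_isBraidedCommutative k H A }.


Lemma eq_kfold_in (k : comUnitRingType) (M N : lmodType k) (P : zmodType)
  (f g : M -> N -> P) t : (forall m n, f m n = g m n) -> kfold f t = kfold g t.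
Proof. exact: eq_kfold. Qed.

Section FoldLemmas.
Variables (k : comUnitRingType) (M N : lmodType k).
Lemma kfold_mull (A : pzRingType) (f : M -> N -> A) t a :
  a * kfold f t = kfold (fun m n => a * f m n) t.
Proof. by apply: kfold_comp => x y; rewrite mulrDr. Qed.
Lemma kfold_mulr (A : pzRingType) (f : M -> N -> A) t a :
  kfold f t * a = kfold (fun m n => f m n * a) t.
Proof. by apply: (@kfold_comp _ _ _ _ _ (fun x => x * a)) => x y; rewrite mulrDl. Qed.
Lemma kfold_scale_out (P : lmodType k) (f : M -> N -> P) t c :
  c *: kfold f t = kfold (fun m n => c *: f m n) t.
Proof. by apply: kfold_comp => x y; rewrite scalerDr. Qed.
Lemma kfold_lin_comp (P Q : lmodType k) (g : P -> Q) (f : M -> N -> P) t : linear g ->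
  g (kfold f t) = kfold (fun m n => g (f m n)) t.
Proof. by move=> h; apply: kfold_comp; apply: linD. Qed.
Lemma kfold_exch (M' N' : lmodType k) (P : zmodType) (f : M -> N -> M' -> N' -> P) t u :
  kfold (fun x y => kfold (f x y) u) t = kfold (fun a b => kfold (fun x y => f x y a b) t) u.
Proof. exact: exchange_big. Qed.
Lemma kfold_tmk' (P : lmodType k) (f : M -> N -> P) m n : bilin f -> kfold f (m ⊗ n) = f m n.
Proof. by move=> h; apply: kfold_tmk; apply: bilin_bal. Qed.
Lemma kfold_kfold' (M' N' : lmodType k) (f : M' -> N' -> ktens M N) (P : lmodType k)
  (g : M -> N -> P) t : bilin g ->
  kfold g (kfold f t) = kfold (fun m n => kfold g (f m n)) t.
Proof. by move=> hg; apply: kfold_comp; apply: kfoldD; apply: bilin_bal. Qed.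
Lemma kfold_addf (P : zmodType) (f g : M -> N -> P) t :
  kfold (fun m n => f m n + g m n) t = kfold f t + kfold g t.
Proof. exact: big_split. Qed.
Lemma kfold_scale_in (P : lmodType k) (F : M -> N -> P) c t : bilin F ->
  kfold F (c *: t) = c *: kfold F t.
Proof. by move=> h; apply: (linZ (kfold_lin h)). Qed.
Lemma ktmk_linl c (x y : M) (n : N) : (c *: x + y) ⊗ n = c *: (x ⊗ n) + (y ⊗ n).
Proof. exact: (ktmk_bilin M N).1. Qed.
Lemma ktmk_linr c (x y : N) (n : M) : n ⊗ (c *: x + y) = c *: (n ⊗ x) + (n ⊗ y).
Proof. exact: (ktmk_bilin M N).2. Qed.
Lemma ktens_lin_ext (P : lmodType k) (g g' : ktens M N -> P) t : linear g -> linear g' ->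
  (forall m n, g (m ⊗ n) = g' (m ⊗ n)) -> g t = g' t.
Proof.
move=> h h' e; rewrite -[t]tens_gen -[tfold _ t]/(kfold ktmk t).
by rewrite (kfold_lin_comp _ _ h) (kfold_lin_comp _ _ h'); apply: eq_kfold.
Qed.
End FoldLemmas.

Ltac linext := idtac.
Ltac linstep :=
  progress (linext; rewrite ?linearP ?act_linl ?act_linr
   ?ktmk_linl ?ktmk_linr
   ?mulrDl ?mulrDr -?scalerAl -?scalerAr ?scalerDl -?[(_ * _) *: _]scalerA).
Ltac linhyp :=
  match goal with
  | h : linear _ |- _ => progress rewrite ?h
  | h : forall _, linear _ |- _ => progress rewrite ?h
  | h : forall _ _, linear _ |- _ => progress rewrite ?h
  | h : forall _ _ _, linear _ |- _ => progress rewrite ?h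
  end.
Ltac linbase := repeat first [linstep | linhyp].

Ltac lin :=
  lazymatch goal with
  | |- bilin _ => split; intro; lin
  | |- linear _ => first [ solve [auto 2] |
      let c := fresh in let x := fresh in let y := fresh in
      intros c x y; cbv beta; lin ]
  | |- forall _, _ => intro; lin
  | |- kfold _ ?t = _ =>
      lazymatch t with
      | context [ _ + _ ] => rewrite ?linearP kfold_lin; [reflexivity | lin]
      | _ => apply: kfold_par => ? ?; lin
      end
  | |- _ => solve [done | linbase; done]
  end.

Section HopfLemmas.
Variables (k : comUnitRingType) (H : hopfAlgType k).
Implicit Types (g h : H) (P : lmodType k).

Lemma coassocE P (F : H -> H -> H -> P) h :
  (forall y z, linear (fun x => F x y z)) -> (forall x z, linear (fun y => F x y z)) ->
  (forall x y, linear (F x y)) ->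
  \ksum_(x, y <- comul h) \ksum_(x1, x2 <- comul x) F x1 x2 y
  = \ksum_(x, y <- comul h) \ksum_(y1, y2 <- comul y) F x y1 y2.
Proof.
move=> h1 h2 h3.
have b1 x : bilin (F x) by lin.
have b : bilin (fun x (t : ktens H H) => kfold (F x) t).
  split=> [t|x]; last exact: kfold_lin.
  by move=> c x y; apply: kfold_par => m n; apply: h1.
have := congr1 (kfold (fun x (t : ktens H H) => kfold (F x) t)) (comulA h).
rewrite (kfold_comp _ _ (kfoldD (bilin_bal b))).
under eq_kfold do rewrite (kfold_comp _ _ (kfoldD (bilin_bal b))).
rewrite (kfold_comp _ _ (kfoldD (bilin_bal b))) => e.
transitivity (\ksum_(m, n <- comul h) \ksum_(m0, n0 <- comul m)
   kfold (fun x (t : ktens H H) => kfold (F x) t) (m0 ⊗ (n0 ⊗ n))).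
  apply: eq_kfold => x y; apply: eq_kfold => x1 x2.
  by rewrite kfold_tmk ?kfold_tmk //; exact: bilin_bal.
rewrite e; apply: eq_kfold => x y.
by rewrite kfold_tmk //; exact: bilin_bal.
Qed.

Lemma kmul2E (A : algType k) P (f : A -> A -> P) t u : bilin f ->
  kfold f (kmul2 t u) = \ksum_(a, b <- t) \ksum_(c, d <- u) f (a * c) (b * d).
Proof.
move=> hf; rewrite /kmul2 kfold_kfold'; last by [].
apply: eq_kfold => a b; rewrite kfold_kfold'; last by [].
by apply: eq_kfold => c d; rewrite kfold_tmk'.
Qed.

Lemma comulME P (f : H -> H -> P) g h : bilin f ->
  kfold f (comul (g * h)) =
  \ksum_(a, b <- comul g) \ksum_(c, d <- comul h) f (a * c) (b * d).
Proof. by move=> hf; rewrite comulM kmul2E. Qed.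

Lemma comul1E P (f : H -> H -> P) : bilin f -> kfold f (comul 1) = f 1 1.
Proof. by move=> hf; rewrite comul1 kfold_tmk'. Qed.

Lemma counitlE P (f : H -> P) h : linear f ->
  \ksum_(x, y <- comul h) (counit x *: f y) = f h.
Proof.
move=> hf; rewrite -[in RHS](counitl h) (kfold_lin_comp _ _ hf).
by apply: eq_kfold => x y; rewrite (linZ hf).
Qed.
Lemma counitrE P (f : H -> P) h : linear f ->
  \ksum_(x, y <- comul h) (counit y *: f x) = f h.
Proof.
move=> hf; rewrite -[in RHS](counitr h) (kfold_lin_comp _ _ hf).
by apply: eq_kfold => x y; rewrite (linZ hf).
Qed.

Lemma antipode1 : antipode 1 = 1 :> H.
Proof.
have := antipodel (1 : H); rewrite comul1E; last by lin.
by rewrite mulr1 counit1 scale1r.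
Qed.

Lemma antipode_lin : linear (antipode : H -> H). Proof. exact: linearP. Qed.


Lemma antipode_ins (f : H -> H) h : linear f ->
  \ksum_(x, y <- comul h) ((\ksum_(x1, x2 <- comul x) (f x1 * x2)) * antipode y) = f h.
Proof.
move=> hf; under eq_kfold_in do rewrite kfold_mulr.
rewrite coassocE; [|by lin..].
rewrite -[RHS](counitrE h hf); apply: eq_kfold => x y.
under eq_kfold_in do rewrite -mulrA.
by rewrite -kfold_mull antipoder -scalerAr mulr1.
Qed.

Lemma antipodeM g h : antipode (g * h) = antipode h * antipode g.
Proof.
have hb x : \ksum_(g1, g2 <- comul x) (antipode (g1 * h) * g2) = counit x *: antipode h.
  pose f z := \ksum_(g1, g2 <- comul x) (antipode (g1 * z) * g2).
  have hf : linear f by rewrite /f; lin.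
  rewrite -[LHS]/(f h) -(antipode_ins h hf).
  rewrite -[antipode h in RHS](counitlE h antipode_lin) kfold_scale_out.
  apply: eq_kfold => z y; rewrite scalerA.
  suff -> : \ksum_(x1, x2 <- comul z) (f x1 * x2) = (counit x * counit z)%:A.
    by rewrite -scalerAl mul1r.
  rewrite -counitM -antipodel comulME; last by lin.
  rewrite kfold_exch; apply: eq_kfold => x1 x2; rewrite /f kfold_mulr.
  by apply: eq_kfold => a b; rewrite mulrA.
have hS : linear (fun x => antipode (x * h)) by lin.
rewrite -(antipode_ins g hS); under eq_kfold_in do rewrite hb -scalerAl.
by rewrite counitlE //; lin.
Qed.

Lemma antipodeVM g h : antipodeV (g * h) = antipodeV h * antipodeV g :> H.
Proof. by apply: (can_inj antipodeK); rewrite antipodeM !antipodeVK. Qed.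
Lemma antipodeV1 : antipodeV 1 = 1 :> H.
Proof. by apply: (can_inj antipodeK); rewrite antipodeVK antipode1. Qed.
Lemma antipodeV_lin : linear (antipodeV : H -> H).
Proof. by move=> c x y; apply: (can_inj antipodeK); rewrite linearP !antipodeVK. Qed.

Lemma antipodeVl h : \ksum_(x, y <- comul h) (antipodeV y * x) = (counit h)%:A.
Proof.
apply: (can_inj antipodeK); rewrite (kfold_lin_comp _ _ antipode_lin).
under eq_kfold_in do rewrite antipodeM antipodeVK.
by rewrite antipodel linearZ /= antipode1.
Qed.
Lemma antipodeVr h : \ksum_(x, y <- comul h) (y * antipodeV x) = (counit h)%:A.
Proof.
apply: (can_inj antipodeK); rewrite (kfold_lin_comp _ _ antipode_lin).
under eq_kfold_in do rewrite antipodeM antipodeVK.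
by rewrite antipoder linearZ /= antipode1.
Qed.

Section Kmul2.
Variable A : algType k.
Implicit Types t u v : ktens A A.
Lemma kmul2_bilin : bilin (@kmul2 k A).
Proof. by split=> [u|t]; rewrite /kmul2; [apply: kfold_lin; lin | lin]. Qed.
Lemma kmul2_linl c t u v : kmul2 (c *: t + u) v = c *: kmul2 t v + kmul2 u v.
Proof. exact: kmul2_bilin.1. Qed.
Lemma kmul2_linr c t u v : kmul2 v (c *: t + u) = c *: kmul2 v t + kmul2 v u.
Proof. exact: kmul2_bilin.2. Qed.
Lemma kmul2_tmk (a b c d : A) : kmul2 (a ⊗ b) (c ⊗ d) = (a * c) ⊗ (b * d).
Proof. by rewrite /kmul2 kfold_tmk' ?kfold_tmk'; try by lin. Qed.
Ltac linext ::= rewrite ?kmul2_linl ?kmul2_linr.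
Lemma kmul2A : associative (@kmul2 k A).
Proof.
move=> t u v.
apply: (ktens_lin_ext (g := fun t => kmul2 t (kmul2 u v)) (g' := fun t => kmul2 (kmul2 t u) v)); [lin|lin|].
move=> a a'.
apply: (ktens_lin_ext (g := fun u => kmul2 _ (kmul2 u v)) (g' := fun u => kmul2 (kmul2 _ u) v)); [lin|lin|].
move=> b b'.
apply: (ktens_lin_ext (g := fun v => kmul2 _ (kmul2 _ v)) (g' := fun v => kmul2 (kmul2 _ _) v)); [lin|lin|].
by move=> c c'; rewrite !kmul2_tmk !mulrA.
Qed.
Lemma kmul2_1l : left_id (1 ⊗ 1) (@kmul2 k A).
Proof.
move=> t; apply: (@ktens_lin_ext k A A (ktens A A) (kmul2 (1 ⊗ 1)) (fun t => t) t); [lin|lin|].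
by move=> a a'; rewrite kmul2_tmk !mul1r.
Qed.
Lemma kmul2_1r : right_id (1 ⊗ 1) (@kmul2 k A).
Proof.
move=> t; refine (@ktens_lin_ext k A A (ktens A A) (fun x => kmul2 x (1 ⊗ 1)) (fun t => t) t _ _ _); [lin|lin|].
by move=> a a'; rewrite kmul2_tmk !mulr1.
Qed.
End Kmul2.

Ltac linext ::= rewrite ?kmul2_linl ?kmul2_linr.
Lemma comul_antipode h :
  comul (antipode h) = \ksum_(x, y <- comul h) (antipode y ⊗ antipode x).
Proof.
have [b1 b2] := @kmul2_bilin H.
pose S2 (x : H) := \ksum_(x1, x2 <- comul x) (antipode x2 ⊗ antipode x1).
have hS2 : linear S2 by rewrite /S2; lin.
have hDS : linear (fun x : H => comul (antipode x)) by lin.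
have hr (x : H) : \ksum_(x1, x2 <- comul x) kmul2 (comul x1) (S2 x2) = counit x *: (1 ⊗ 1).
  transitivity (\ksum_(x1, x2 <- comul x) \ksum_(p, q <- comul x1) \ksum_(y1, y2 <- comul x2)
     ((p * antipode y2) ⊗ (q * antipode y1))).
    apply: eq_kfold => x1 x2; rewrite /S2 (kfold_lin_comp _ _ (b2 _)) kfold_exch.
    apply: eq_kfold => y1 y2; rewrite /kmul2; apply: eq_kfold => p q.
    by rewrite kfold_tmk' //; lin.
  rewrite coassocE; [|lin..].
  transitivity (\ksum_(p, z <- comul x) \ksum_(w, y2 <- comul z) \ksum_(q, y1 <- comul w)
     ((p * antipode y2) ⊗ (q * antipode y1))).
    by apply: eq_kfold => p z; rewrite coassocE; [|lin..].
  transitivity (\ksum_(p, z <- comul x) ((p * antipode z) ⊗ (1 : H))).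
    apply: eq_kfold => p z.
    have hf : linear (fun y : H => (p * antipode y) ⊗ (1 : H)) by lin.
    rewrite -[RHS](counitlE z hf); apply: eq_kfold => w y2.
    have hg : linear (fun y : H => (p * antipode y2) ⊗ y) by lin.
    by rewrite -(kfold_lin_comp _ _ hg) antipoder (linZ hg).
  have hg : linear (fun y : H => y ⊗ (1 : H)) by lin.
  by rewrite -(kfold_lin_comp _ _ hg) antipoder (linZ hg).
have hl (x : H) : \ksum_(x1, x2 <- comul x) kmul2 (comul (antipode x1)) (comul x2) = counit x *: (1 ⊗ 1).
  under eq_kfold_in do rewrite -comulM.
  rewrite -(kfold_lin_comp _ _ (g := comul)); last by exact: linearP.
  by rewrite antipodel linearZ /= comul1.
rewrite -[LHS](counitrE (f := fun x => comul (antipode x)) h hDS) -[RHS](counitlE h hS2).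
transitivity (\ksum_(x, y <- comul h) \ksum_(y1, y2 <- comul y)
  kmul2 (comul (antipode x)) (kmul2 (comul y1) (S2 y2))).
  apply: eq_kfold => x y; rewrite -(kfold_lin_comp _ _ (b2 _)) hr.
  by rewrite (linZ (b2 _)) kmul2_1r.
rewrite -coassocE; [|by lin..].
apply: eq_kfold => x y.
under eq_kfold_in do rewrite kmul2A.
rewrite -(kfold_lin_comp _ _ (g := fun w => kmul2 w (S2 y))) ?hl; last by lin.
by rewrite (linZ (b1 _)) kmul2_1l.
Qed.

Lemma comul_antipodeE P (f : H -> H -> P) h : bilin f ->
  kfold f (comul (antipode h)) = \ksum_(x, y <- comul h) f (antipode y) (antipode x).
Proof.
move=> hf; rewrite comul_antipode kfold_kfold' //.
by apply: eq_kfold => x y; rewrite kfold_tmk'.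
Qed.

Ltac linext ::= rewrite ?antipodeV_lin.
Lemma comul_antipodeVE P (f : H -> H -> P) h : bilin f ->
  kfold f (comul (antipodeV h)) = \ksum_(x, y <- comul h) f (antipodeV y) (antipodeV x).
Proof.
case=> h1 h2.
rewrite -[in RHS](antipodeVK h) comul_antipodeE.
  by apply: eq_kfold => x y; rewrite !antipodeK.
split=> [n|m] c x y; rewrite antipodeV_lin; [exact: h2|exact: h1].
Qed.

End HopfLemmas.

Section RMatrixLemmas.
Variables (k : comUnitRingType) (H : triangularHopfAlgType k).
Implicit Types (P : lmodType k) (h : H).
Local Notation Rb := (univRV : ktens H H).
Local Notation R := (univR : ktens H H).
Ltac linext ::= idtac.

Definition trilin P (F : H -> H -> H -> P) :=
  [/\ forall y z, linear (fun x => F x y z), forall x z, linear (fun y => F x y z)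
    & forall x y, linear (F x y)].

Lemma fold3_bilin P (F : H -> H -> H -> P) : trilin F ->
  bilin (fun x (t : ktens H H) => kfold (F x) t).
Proof.
case=> h1 h2 h3; split=> [t|x]; last by apply: kfold_lin; lin.
by move=> c x y; apply: kfold_par => m n; apply: h1.
Qed.

Lemma fold3_tmk P (F : H -> H -> H -> P) a b c : trilin F ->
  kfold (fun x (t : ktens H H) => kfold (F x) t) (a ⊗ (b ⊗ c)) = F a b c.
Proof.
move=> hF; rewrite kfold_tmk'; last exact: fold3_bilin.
by case: hF => h1 h2 h3; rewrite kfold_tmk' //; lin.
Qed.

Ltac linext ::= rewrite ?kmul2_linl ?kmul2_linr.
Lemma kmul3_tmk (a b c a' b' c' : H) :
  kmul3 (a ⊗ (b ⊗ c)) (a' ⊗ (b' ⊗ c')) = (a * a') ⊗ ((b * b') ⊗ (c * c')).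
Proof.
rewrite /kmul3 kfold_tmk'; last by lin.
by rewrite kfold_tmk' ?kmul2_tmk //; lin.
Qed.

Lemma kmul3_linl (v : ktens H (ktens H H)) : linear (fun t => kmul3 t v).
Proof. by rewrite /kmul3; lin. Qed.
Lemma kmul3_linr (v : ktens H (ktens H H)) : linear (kmul3 v).
Proof. by rewrite /kmul3; lin. Qed.
Ltac linext ::= idtac.

Lemma univR_comullE P (F : H -> H -> H -> P) : trilin F ->
  \ksum_(x, y <- R) \ksum_(x1, x2 <- comul x) F x1 x2 y
  = \ksum_(x, y <- R) \ksum_(x', y' <- R) F x x' (y * y').
Proof.
move=> hF; have hb := fold3_bilin hF.
have := congr1 (kfold (fun x (t : ktens H H) => kfold (F x) t)) (@univR_comull k H).
rewrite kfold_kfold' //; under eq_kfold_in do rewrite kfold_kfold' //.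
under eq_kfold_in do under eq_kfold_in do rewrite fold3_tmk //.
move=> ->; rewrite /leg13 (kfold_lin_comp _ _ (@kmul3_linl _)) kfold_kfold' //.
apply: eq_kfold => x y; rewrite /leg23 (kfold_lin_comp _ _ (@kmul3_linr _)) kfold_kfold' //.
by apply: eq_kfold => x' y'; rewrite kmul3_tmk fold3_tmk // mul1r mulr1.
Qed.

Lemma univR_comulrE P (F : H -> H -> H -> P) : trilin F ->
  \ksum_(x, y <- R) \ksum_(y1, y2 <- comul y) F x y1 y2
  = \ksum_(x, y <- R) \ksum_(x', y' <- R) F (x * x') y' y.
Proof.
move=> hF; have hb := fold3_bilin hF.
have := congr1 (kfold (fun x (t : ktens H H) => kfold (F x) t)) (@univR_comulr k H).
rewrite kfold_kfold' //; under eq_kfold_in do rewrite kfold_tmk' //.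
move=> ->; rewrite /leg13 (kfold_lin_comp _ _ (@kmul3_linl _)) kfold_kfold' //.
apply: eq_kfold => x y; rewrite /leg12 (kfold_lin_comp _ _ (@kmul3_linr _)) kfold_kfold' //.
by apply: eq_kfold => x' y'; rewrite kmul3_tmk fold3_tmk // mul1r mulr1.
Qed.

Lemma univRVE P (f : H -> H -> P) : bilin f ->
  kfold f Rb = \ksum_(x, y <- R) f y x.
Proof.
move=> hf; rewrite -univR_triangular /kswap kfold_kfold' //.
by apply: eq_kfold => x y; rewrite kfold_tmk'.
Qed.

Lemma univRE P (f : H -> H -> P) : bilin f ->
  kfold f R = \ksum_(x, y <- Rb) f y x.
Proof. by case=> h1 h2; rewrite univRVE //; lin. Qed.

Lemma univRV_comulr P (F : H -> H -> H -> P) : trilin F ->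
  \ksum_(p, q <- Rb) \ksum_(q1, q2 <- comul q) F p q1 q2
  = \ksum_(p, q <- Rb) \ksum_(p', q' <- Rb) F (p * p') q q'.
Proof.
case=> h1 h2 h3; rewrite univRVE; last by lin.
rewrite (univR_comullE (F := fun a b c => F c a b)); last by split; lin.
rewrite [RHS]univRVE; last by lin.
apply: eq_kfold => x y; rewrite univRVE //; lin.
Qed.

Lemma univRV_comull P (F : H -> H -> H -> P) : trilin F ->
  \ksum_(p, q <- Rb) \ksum_(p1, p2 <- comul p) F p1 p2 q
  = \ksum_(p, q <- Rb) \ksum_(p', q' <- Rb) F p' p (q * q').
Proof.
case=> h1 h2 h3; rewrite univRVE; last by lin.
rewrite (univR_comulrE (F := fun a b c => F b c a)); last by split; lin.
rewrite [RHS]univRVE; last by lin.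
apply: eq_kfold => x y; rewrite univRVE //; lin.
Qed.

Lemma univRV_cocomm P (F : H -> H -> P) h : bilin F ->
  \ksum_(h1, h2 <- comul h) \ksum_(p, q <- Rb) F (h1 * p) (h2 * q)
  = \ksum_(p, q <- Rb) \ksum_(h1, h2 <- comul h) F (p * h2) (q * h1).
Proof.
move=> hF; rewrite -kmul2E //.
have -> : kmul2 (comul h) Rb = kmul2 Rb (kswap (comul h)).
  by rewrite quasi_cocommutative !kmul2A univRVK kmul2_1l.
rewrite kmul2E //; apply: eq_kfold => p q; case: hF => h1 h2.
rewrite /kswap kfold_kfold'; last by lin.
by apply: eq_kfold => x y; rewrite kfold_tmk' //; lin.
Qed.

Lemma univRV_flip P (F : H -> H -> P) : bilin F ->
  \ksum_(p, q <- Rb) \ksum_(p', q' <- Rb) F (p * q') (q * p') = F 1 1.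
Proof.
move=> hF; have [h1 h2] := hF.
rewrite -[RHS](kfold_tmk' 1 1 hF) -(@univRVK k H) kmul2E //.
by apply: eq_kfold => p q; rewrite [RHS]univRE //; lin.
Qed.

Lemma kfold_tmk_id (M N : lmodType k) (t : ktens M N) : kfold ktmk t = t.
Proof. exact: tens_gen. Qed.

Lemma counit_lin c (x y : H) : counit (c *: x + y) = c * counit x + counit y.
Proof. exact: linearP. Qed.

Lemma univRV_counitl : \ksum_(p, q <- Rb) (counit p *: q) = 1.
Proof.
set e := LHS.
have h : kmul2 Rb (1 ⊗ e) = Rb.
  transitivity (\ksum_(p, q <- Rb) \ksum_(p1, p2 <- comul p) (counit p1 *: (p2 ⊗ q))).
    rewrite univRV_comull; last by split; lin.
    rewrite -[X in kmul2 X]kfold_tmk_id (kfold_lin_comp (g := fun x => kmul2 x (1 ⊗ e))).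
      apply: eq_kfold => p q; rewrite /e kmul2_tmk kfold_mull mulr1.
      rewrite (kfold_lin_comp (g := fun z => p ⊗ z)); last by lin.
      by apply: eq_kfold => p' q'; rewrite -scalerAr (linZ ((ktmk_bilin _ _).2 p)).
    by move=> c x y; rewrite kmul2_linl.
  rewrite -[RHS]kfold_tmk_id; apply: eq_kfold => p q.
  by rewrite (counitlE (f := fun x => x ⊗ q)) //; lin.
have h1 : (1 : H) ⊗ e = 1 ⊗ 1.
  by rewrite -(@univRK k H) -[in RHS]h kmul2A univRK kmul2_1l.
have := congr1 (kfold (fun x y : H => counit x *: y)) h1.
have hb : bilin (fun x y : H => counit x *: y).
  by split=> [n|m] c x y; rewrite ?counit_lin ?scalerDl ?scalerDr ?scalerA // mulrC.
by rewrite !kfold_tmk' // counit1 !scale1r.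
Qed.

Lemma univRV_counitr : \ksum_(p, q <- Rb) (counit q *: p) = 1.
Proof.
set e := LHS.
have h : kmul2 (e ⊗ 1) Rb = Rb.
  transitivity (\ksum_(p, q <- Rb) \ksum_(q1, q2 <- comul q) (counit q1 *: (p ⊗ q2))).
    rewrite univRV_comulr; last by split; lin.
    transitivity (\ksum_(p, q <- Rb) kmul2 ((counit q *: p) ⊗ 1) Rb).
      rewrite -(kfold_lin_comp (g := fun z => kmul2 (z ⊗ 1) Rb)) //.
      by move=> c x y; rewrite ktmk_linl kmul2_linl.
    apply: eq_kfold => p q.
    rewrite -[X in kmul2 _ X]kfold_tmk_id (kfold_lin_comp (g := kmul2 _)); last first.
      by move=> c x y; rewrite kmul2_linr.
    apply: eq_kfold => p' q'; rewrite kmul2_tmk mul1r -scalerAl.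
    by rewrite (linZ ((ktmk_bilin _ _).1 q')).
  rewrite -[RHS]kfold_tmk_id; apply: eq_kfold => p q.
  by rewrite (counitlE (f := fun x => p ⊗ x)) //; lin.
have h1 : e ⊗ (1 : H) = 1 ⊗ 1.
  by rewrite -(@univRVK k H) -[in RHS]h -kmul2A univRVK kmul2_1r.
have := congr1 (kfold (fun x y : H => counit y *: x)) h1.
have hb : bilin (fun x y : H => counit y *: x).
  by split=> [n|m] c x y; rewrite ?counit_lin ?scalerDl ?scalerDr ?scalerA // mulrC.
by rewrite !kfold_tmk' // counit1 !scale1r.
Qed.
End RMatrixLemmas.

(* The operations of an H-equivariant A-bimodule; the base ring k acts through A,
   so that only the underlying abelian group is recorded. *)
Record bimodOps (k : comUnitRingType) (H : hopfAlgType k) (A : hopfModuleAlgType H) :=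
  BimodOps {
  bimod_sort :> zmodType;
  lact : A -> bimod_sort -> bimod_sort;
  ract : bimod_sort -> A -> bimod_sort;
  hact : H -> bimod_sort -> bimod_sort
}.
Arguments lact {k H A b}.
Arguments ract {k H A b}.
Arguments hact {k H A b}.
Notation "a *> v" := (lact a v) (at level 40, left associativity) : ring_scope.
Notation "v <* a" := (ract v a) (at level 40, left associativity) : ring_scope.
Notation "h ▷ v" := (hact h v) (at level 40, left associativity) : ring_scope.

Record isEquivBimod (k : comUnitRingType) (H : hopfAlgType k) (A : hopfModuleAlgType H)
    (M : bimodOps A) : Prop := IsEquivBimod {
  lact_addl : forall (a b : A) (v : M), (a + b) *> v = a *> v + b *> v;
  lact_addr : forall (a : A) (v w : M), a *> (v + w) = a *> v + a *> w;
  lact_mul : forall (a b : A) (v : M), (a * b) *> v = a *> (b *> v);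
  lact_one : forall v : M, (1 : A) *> v = v;
  ract_addl : forall (v w : M) (a : A), (v + w) <* a = v <* a + w <* a;
  ract_addr : forall (v : M) (a b : A), v <* (a + b) = v <* a + v <* b;
  ract_mul : forall (v : M) (a b : A), v <* (a * b) = (v <* a) <* b;
  ract_one : forall v : M, v <* (1 : A) = v;
  lract_assoc : forall (a b : A) (v : M), (a *> v) <* b = a *> (v <* b);
  lract_base : forall (c : k) (v : M), (c%:A : A) *> v = v <* (c%:A : A);
  hact_addl : forall (g h : H) (v : M), (g + h) ▷ v = g ▷ v + h ▷ v;
  hact_addr : forall (h : H) (v w : M), h ▷ (v + w) = h ▷ v + h ▷ w;
  hact_mul : forall (g h : H) (v : M), (g * h) ▷ v = g ▷ (h ▷ v);
  hact_one : forall v : M, (1 : H) ▷ v = v;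
  hact_scale : forall (c : k) (h : H) (v : M), (c *: h) ▷ v = (c%:A : A) *> (h ▷ v);
  hact_lact : forall (h : H) (a : A) (v : M),
    h ▷ (a *> v) = \ksum_(x, y <- comul h) (act x a *> (y ▷ v));
  hact_ract : forall (h : H) (v : M) (a : A),
    h ▷ (v <* a) = \ksum_(x, y <- comul h) ((x ▷ v) <* act y a)
}.

Record equivBimod (k : comUnitRingType) (H : hopfAlgType k) (A : hopfModuleAlgType H) :=
  EquivBimod {
  equivBimod_ops :> bimodOps A;
  equivBimodP : isEquivBimod equivBimod_ops
}.

Lemma coassoc4E (k : comUnitRingType) (H : hopfAlgType k) (P : lmodType k)
    (F : H -> H -> H -> H -> P) h :
  (forall x y z, linear (fun t => F t x y z)) -> (forall x y z, linear (fun t => F x t y z)) ->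
  (forall x y z, linear (fun t => F x y t z)) -> (forall x y z, linear (F x y z)) ->
  \ksum_(x, y <- comul h) \ksum_(x1, x2 <- comul x) \ksum_(y1, y2 <- comul y) F x1 x2 y1 y2
  = \ksum_(x, y <- comul h) \ksum_(y1, y2 <- comul y) \ksum_(z1, z2 <- comul y1) F x z1 z2 y2.
Proof.
move=> h1 h2 h3 h4; rewrite coassocE; [|by lin..].
by apply: eq_kfold => x y; rewrite coassocE; [|by lin..].
Qed.

Section Act.
Variables (k : comUnitRingType) (H : hopfAlgType k) (A : hopfModuleAlgType H).
Lemma act_addl c (g h : H) (a : A) : act (c *: g + h) a = c *: act g a + act h a.
Proof. exact: act_linl. Qed.
Lemma act_addr (h : H) c (a b : A) : act h (c *: a + b) = c *: act h a + act h b.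
Proof. exact: act_linr. Qed.
Lemma actZr (h : H) c (a : A) : act h (c *: a) = c *: act h a.
Proof. exact: (linZ (act_linr h)). Qed.
Lemma actZl (h : H) c (a : A) : act (c *: h) a = c *: act h a.
Proof. exact: (linZ (act_linl a)). Qed.

(* The adjoint H-action on maps A -> A. *)
Definition hact_fun (h : H) (u : A -> A) : A -> A :=
  fun a => \ksum_(x, y <- comul h) act x (u (act (antipode y) a)).

Variables (u : A -> A) (hu : linear u).
Ltac linext ::= rewrite ?act_addl ?act_addr.

Lemma hact_fun_lin h : linear (hact_fun h u).
Proof. by rewrite /hact_fun; lin. Qed.

Lemma hact_fun_linl a : linear (fun h => hact_fun h u a).
Proof. by rewrite /hact_fun; lin. Qed.

Lemma hact_fun1 a : hact_fun 1 u a = u a.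
Proof. by rewrite /hact_fun comul1E; [rewrite antipode1 !act1l | lin]. Qed.

Lemma hact_funM g h a : hact_fun (g * h) u a = hact_fun g (hact_fun h u) a.
Proof.
rewrite /hact_fun comulME; last by lin.
apply: eq_kfold => x y; rewrite (kfold_lin_comp _ _ (act_linr x)).
by apply: eq_kfold => x' y'; rewrite antipodeM !actMl.
Qed.

Lemma act_base (h : H) c : act h (c%:A : A) = counit h *: c%:A.
Proof. by rewrite actZr act1r !scalerA mulrC. Qed.

Lemma act_scalar (c : k) (a : A) : act (c%:A : H) a = c *: a.
Proof. by rewrite actZl act1l. Qed.

Lemma hact_fun_ev h a : act h (u a) = \ksum_(x, y <- comul h) hact_fun x u (act y a).
Proof.
rewrite /hact_fun coassocE; [|by lin..].
have hf : linear (fun x : H => act x (u a)) by lin.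
rewrite -(counitrE h hf); apply: eq_kfold => x y.
have hg : linear (fun z : H => act x (u (act z a))) by lin.
under eq_kfold_in do rewrite -actMl.
by rewrite -(kfold_lin_comp _ _ hg) antipodel act_scalar (linZ hu) actZr.
Qed.

Lemma hact_fun_lact h a b :
  hact_fun h (fun b => a * u b) b = \ksum_(x, y <- comul h) (act x a * hact_fun y u b).
Proof.
rewrite /hact_fun; under eq_kfold_in do rewrite actMr.
rewrite coassocE; [|by lin..].
by apply: eq_kfold => x y; rewrite kfold_mull.
Qed.

Lemma hact_fun_comp (v : A -> A) h a : linear v ->
  hact_fun h (fun b => u (v b)) a = \ksum_(x, y <- comul h) hact_fun x u (hact_fun y v a).
Proof.
move=> hv; rewrite {1}/hact_fun.
under eq_kfold_in do rewrite hact_fun_ev.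
rewrite coassocE.
- by apply: eq_kfold => x y; rewrite (kfold_lin_comp _ _ (hact_fun_lin x)).
- by move=> y z; exact: hact_fun_linl.
- move=> x z c y y'; rewrite act_addl; exact: hact_fun_lin.
- move=> x y c z z'. rewrite linearP act_addl hv act_addr; exact: hact_fun_lin.
Qed.
End Act.

Section VectorFields.
Variables (k : comUnitRingType) (H : triangularHopfAlgType k) (A : braidedComAlgType H).
Local Notation Rb := (univRV : ktens H H).
Implicit Types (u v w : A -> A).

Definition braided_derivation u : Prop :=
  linear u /\ forall a b : A,
    u (a * b) = u a * b + \ksum_(x, y <- Rb) (act x a * hact_fun y u b).

Definition braided_der : {pred A -> A} := fun u => `[< braided_derivation u >].

Lemma hact_funD h u v a : hact_fun h (u + v) a = hact_fun h u a + hact_fun h v a.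
Proof.
rewrite /hact_fun -kfold_addf; apply: eq_kfold => x y.
by rewrite -(linD (act_linr x)).
Qed.
Lemma hact_funN h u a : hact_fun h (- u) a = - hact_fun h u a.
Proof.
rewrite /hact_fun (kfold_comp (g := -%R)); last exact: opprD.
apply: eq_kfold => x y.
by have := linZ (act_linr x) (-1) (u (act (antipode y) a)); rewrite !scaleN1r.
Qed.

Fact braided_der_zmod : zmod_closed braided_der.
Proof.
split=> [|u v /asboolP[hu du] /asboolP[hv dv]]; apply/asboolP; split.
- by move=> c a b; rewrite scaler0 addr0.
- move=> a b; rewrite mul0r add0r.
  apply/esym/big1 => p _ /=; rewrite {1}/hact_fun /kfold /tfold /fsum.
  by rewrite big1 ?mulr0 // => q _; rewrite (lin0 (act_linr _)).
- move=> c a b; rewrite !fctE hu hv scalerBr !opprD addrACA //.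
- move=> a b; rewrite !fctE du dv mulrBl opprD addrACA; congr (_ + _).
  rewrite (kfold_comp (g := -%R)); last exact: opprD.
  rewrite -kfold_addf; apply: eq_kfold => x y.
  by rewrite hact_funD hact_funN mulrDr mulrN.
Qed.

Ltac linext ::= rewrite ?act_addl ?act_addr.

Lemma act_tens_antipode (h : H) (a b : A) :
  act (antipode h) (a * b) =
  \ksum_(x, y <- comul h) (act (antipode y) a * act (antipode x) b).
Proof. by rewrite actMr comul_antipodeE //; lin. Qed.

Lemma hact_fun_linE u c (g h : H) (a : A) : linear u ->
  hact_fun (c *: g + h) u a = c *: hact_fun g u a + hact_fun h u a.
Proof. by move=> hu; apply: hact_fun_linl. Qed.

Lemma hact_fun_linrE u (h : H) c (a b : A) : linear u ->
  hact_fun h u (c *: a + b) = c *: hact_fun h u a + hact_fun h u b.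
Proof. by move=> hu; apply: hact_fun_lin. Qed.

Lemma hact_fun_der h u : braided_derivation u -> braided_derivation (hact_fun h u).
Proof.
case=> hu du; split; first exact: hact_fun_lin.
Ltac linext ::= rewrite ?act_addl ?act_addr ?hact_fun_linE ?hact_fun_linrE //.
move=> b c.

transitivity (
  \ksum_(x, y <- comul h) \ksum_(x1, x2 <- comul x) \ksum_(y1, y2 <- comul y)
    (act x1 (u (act (antipode y2) b)) * act (x2 * antipode y1) c)
  + \ksum_(x, y <- comul h) \ksum_(x1, x2 <- comul x) \ksum_(y1, y2 <- comul y)
      \ksum_(p, q <- Rb)
      (act (x1 * p * antipode y2) b * act x2 (hact_fun q u (act (antipode y1) c)))).
  rewrite -kfold_addf; apply: eq_kfold => x y.
  rewrite act_tens_antipode (kfold_lin_comp _ _ hu).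
  rewrite (kfold_lin_comp _ _ (act_linr x)) -kfold_addf [RHS](eq_kfold_in (g := fun x1 x2 =>
    \ksum_(y1, y2 <- comul y) (act x1 (u (act (antipode y2) b)) * act (x2 * antipode y1) c
     + \ksum_(p, q <- Rb)
      (act (x1 * p * antipode y2) b * act x2 (hact_fun q u (act (antipode y1) c)))))); last first.
    by move=> x1 x2; rewrite kfold_addf.
  rewrite kfold_exch; apply: eq_kfold => y1 y2.
  rewrite du (linD (act_linr x)) kfold_addf actMr; congr (_ + _).
    by apply: eq_kfold => x1 x2; rewrite actMl.
  rewrite (kfold_lin_comp _ _ (act_linr x)) kfold_exch; apply: eq_kfold => p q.
  by rewrite actMr; apply: eq_kfold => x1 x2; rewrite !actMl.
congr (_ + _).
  rewrite coassoc4E; [|by lin..].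
  rewrite /hact_fun kfold_mulr; apply: eq_kfold => x y.
  have hf : linear (fun y => act x (u (act (antipode y) b)) * c) by lin.
  rewrite -[RHS](counitlE y hf); apply: eq_kfold => w y2.
  rewrite -kfold_mull; have hg : linear (fun z : H => act z c) by lin.
  by rewrite -(kfold_lin_comp _ _ hg) antipoder act_scalar -scalerAr.
rewrite coassoc4E; [|by lin..].
transitivity (\ksum_(x, z <- comul h) \ksum_(w, y2 <- comul z)
    \ksum_(p, q <- Rb) (act (x * p * antipode y2) b * hact_fun (w * q) u c)).
  apply: eq_kfold => x z; apply: eq_kfold => w y2.
  rewrite kfold_exch; apply: eq_kfold => p q.
  by rewrite -kfold_mull hact_funM.
rewrite -coassocE; [|by lin..].
transitivity (\ksum_(m, y2 <- comul h) \ksum_(m1, m2 <- comul m)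
   \ksum_(p, q <- Rb) (act (p * (m2 * antipode y2)) b * hact_fun (q * m1) u c)).
  apply: eq_kfold => m y2.
  rewrite (univRV_cocomm (F := fun g g' : H => act (g * antipode y2) b * hact_fun g' u c)); last by lin.
  by rewrite kfold_exch; apply: eq_kfold => m1 m2; apply: eq_kfold => p q; rewrite mulrA.
rewrite coassocE; [|by lin..].
transitivity (\ksum_(m1, z <- comul h) (counit z *: \ksum_(p, q <- Rb) (act p b * hact_fun (q * m1) u c))).
  apply: eq_kfold => m1 z; rewrite kfold_exch kfold_scale_out; apply: eq_kfold => p q.
  have hf : linear (fun t : H => act (p * t) b * hact_fun (q * m1) u c) by lin.
  by rewrite -(kfold_lin_comp _ _ hf) antipoder (linZ hf) mulr1.
have hf : linear (fun m1 : H => \ksum_(p, q <- Rb) (act p b * hact_fun (q * m1) u c)) by lin.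
rewrite (counitrE h hf); apply: eq_kfold => p q.
by rewrite hact_funM.
Qed.

Lemma lact_fun_der a u : braided_derivation u -> braided_derivation (fun b => a * u b).
Proof.
case=> hu du; split; first by lin.
move=> b c; rewrite du mulrDr mulrA; congr (_ + _).
transitivity (\ksum_(p, q <- Rb) \ksum_(q1, q2 <- comul q) (act p b * (act q1 a * hact_fun q2 u c))).
  rewrite univRV_comulr; last by split; lin.
  rewrite kfold_exch kfold_mull; apply: eq_kfold => p' q'.
  rewrite mulrA (braided_mulC a) kfold_mulr; apply: eq_kfold => p q.
  by rewrite actMl mulrA.
apply: eq_kfold => p q.
by rewrite hact_fun_lact // kfold_mull.
Qed.

Lemma hact_fun_fold (M N : lmodType k) (F : M -> N -> A -> A) (t : ktens M N) h a :
  hact_fun h (fun b => kfold (fun x y => F x y b) t) a = kfold (fun x y => hact_fun h (F x y) a) t.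
Proof.
rewrite /hact_fun kfold_exch; apply: eq_kfold => x y.
by rewrite (kfold_lin_comp _ _ (act_linr x)).
Qed.

Definition bracket_fun u v : A -> A :=
  fun a => u (v a) - \ksum_(x, y <- Rb) hact_fun x v (hact_fun y u a).

Lemma bracket_fun_der u v :
  braided_derivation u -> braided_derivation v -> braided_derivation (bracket_fun u v).
Proof.
move=> Du Dv; have [hu du] := Du; have [hv dv] := Dv.
split.
  move=> c a b; rewrite /bracket_fun hv hu.
  have hl : linear (fun a => \ksum_(x, y <- Rb) hact_fun x v (hact_fun y u a)) by lin.
  by rewrite hl scalerBr opprD addrACA.
pose II (w z : A -> A) (a b : A) := \ksum_(r, s <- Rb) (act r (z a) * hact_fun s w b).
pose III (w z : A -> A) (a b : A) := \ksum_(r, s <- Rb) (w (act r a) * hact_fun s z b).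
have comp w z a b : braided_derivation w -> braided_derivation z ->
   w (z (a * b)) = w (z a) * b + II w z a b + III w z a b
     + \ksum_(r, s <- Rb) (act r a * hact_fun s (fun b => w (z b)) b).
  move=> [hw dw] [hz dz]; rewrite dz (linD hw) dw -!addrA; congr (_ + (_ + _)).
  rewrite (kfold_lin_comp _ _ hw); under eq_kfold_in do rewrite dw.
  rewrite kfold_addf; congr (_ + _).
  under [in RHS]eq_kfold_in do rewrite hact_fun_comp // kfold_mull.
  rewrite univRV_comulr; last by split; lin.
  by rewrite kfold_exch; apply: eq_kfold => p q; apply: eq_kfold => p' q'; rewrite actMl.
have e1 a b : \ksum_(p, q <- Rb) III (hact_fun p v) (hact_fun q u) a b = II u v a b.
  rewrite /II; under [in RHS]eq_kfold_in do rewrite hact_fun_ev // kfold_mulr.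
  rewrite univRV_comull; last by split; lin.
  rewrite kfold_exch /III; apply: eq_kfold => p q; apply: eq_kfold => r s.
  by rewrite hact_funM.
have e2 a b : \ksum_(p, q <- Rb) II (hact_fun p v) (hact_fun q u) a b = III u v a b.
  pose G r s (x y : H) := hact_fun x u (act r a) * hact_fun (s * y) v b.
  transitivity (\ksum_(p, q <- Rb) \ksum_(r, s <- Rb) \ksum_(r', s' <- Rb) G r s (r' * q) (s' * p)).
    apply: eq_kfold => p q; rewrite /II.
    transitivity (\ksum_(r, s <- Rb) \ksum_(r1, r2 <- comul r)
       (hact_fun (r1 * q) u (act r2 a) * hact_fun (s * p) v b)).
      apply: eq_kfold => r s; rewrite hact_fun_ev ?kfold_mulr; last exact: hact_fun_lin.
      by apply: eq_kfold => r1 r2; rewrite !hact_funM.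
    rewrite (univRV_comull (F := fun r1 r2 s => hact_fun (r1 * q) u (act r2 a) * hact_fun (s * p) v b)); last by split; lin.
    by apply: eq_kfold => r s; apply: eq_kfold => r' s'; rewrite /G mulrA.
  rewrite kfold_exch /III; apply: eq_kfold => r s.
  rewrite kfold_exch (univRV_flip (F := G r s)); last by rewrite /G; lin.
  by rewrite /G hact_fun1 // mulr1.
move=> a b; rewrite /bracket_fun (comp u v) //.
have Dh (h : H) w : braided_derivation w -> braided_derivation (hact_fun h w).
  exact: hact_fun_der.
have -> : \ksum_(x, y <- Rb) hact_fun x v (hact_fun y u (a * b)) =
   (\ksum_(x, y <- Rb) hact_fun x v (hact_fun y u a)) * b + III u v a b + II u v a b
   + \ksum_(r, s <- Rb) (act r a * hact_fun s (fun b => \ksum_(x, y <- Rb) hact_fun x v (hact_fun y u b)) b).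
  rewrite -e1 -e2 kfold_mulr.
  have -> : \ksum_(r, s <- Rb) (act r a * hact_fun s (fun b => \ksum_(x, y <- Rb) hact_fun x v (hact_fun y u b)) b)
    = \ksum_(x, y <- Rb) \ksum_(r, s <- Rb) (act r a * hact_fun s (fun b => hact_fun x v (hact_fun y u b)) b).
    by rewrite kfold_exch; apply: eq_kfold => r s; rewrite hact_fun_fold kfold_mull.
  rewrite -!kfold_addf; apply: eq_kfold => x y.
  by rewrite (comp _ _ _ _ (Dh x v Dv) (Dh y u Du)) -[_ + II _ _ _ _ + _]addrA [II _ _ _ _ + _]addrC addrA.
have -> : \ksum_(x, y <- Rb) (act x a * hact_fun y (fun a => u (v a) - \ksum_(x, y <- Rb) hact_fun x v (hact_fun y u a)) b)
  = \ksum_(x, y <- Rb) (act x a * hact_fun y (fun b => u (v b)) b)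
   - \ksum_(x, y <- Rb) (act x a * hact_fun y (fun a => \ksum_(x, y <- Rb) hact_fun x v (hact_fun y u a)) b).
  rewrite (kfold_comp (g := -%R)); last exact: opprD.
  rewrite -kfold_addf; apply: eq_kfold => x y.
  rewrite -mulrBr; congr (_ * _); rewrite -hact_funN -hact_funD //.
rewrite mulrBl.
rewrite opprD addrACA; congr (_ + _).
by rewrite -[_ + II _ _ _ _ + III _ _ _ _]addrA -[_ + III _ _ _ _ + II _ _ _ _]addrA [III _ _ _ _ + II _ _ _ _]addrC opprD addrACA subrr addr0.
Qed.

Record vectorField := VectorField {
  vf_fun :> A -> A;
  vf_fun_der : vf_fun \in braided_der
}.
HB.instance Definition _ := GRing.isZmodClosed.Build (A -> A) braided_der braided_der_zmod.
HB.instance Definition _ := [isSub for vf_fun].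
HB.instance Definition _ := [Choice of vectorField by <:].
HB.instance Definition _ := [SubChoice_isSubZmodule of vectorField by <:].

Lemma vf_der (u : vectorField) : braided_derivation u.
Proof. by apply/asboolP; exact: vf_fun_der. Qed.

Definition vf_mk (u : A -> A) (hu : braided_derivation u) : vectorField :=
  @VectorField u (asboolT hu).

Definition vf_lact (a : A) (u : vectorField) : vectorField :=
  vf_mk (lact_fun_der a (vf_der u)).
Definition vf_hact (h : H) (u : vectorField) : vectorField :=
  vf_mk (hact_fun_der h (vf_der u)).
Definition vf_ract (u : vectorField) (a : A) : vectorField :=
  \ksum_(x, y <- Rb) vf_lact (act x a) (vf_hact y u).
Definition vf_bracket (u v : vectorField) : vectorField :=
  vf_mk (bracket_fun_der (vf_der u) (vf_der v)).

Definition vf_ops : bimodOps A := BimodOps vf_lact vf_ract vf_hact.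

Lemma vf_ext (u v : vectorField) : (forall a, u a = v a) -> u = v.
Proof. by move=> h; apply: val_inj; apply: funext. Qed.
Lemma vf_addE (u v : vectorField) a : (u + v) a = u a + v a.
Proof. by []. Qed.
Lemma vf_lactE a (u : vectorField) b : vf_lact a u b = a * u b. Proof. by []. Qed.
Lemma vf_hactE h (u : vectorField) b : vf_hact h u b = hact_fun h u b. Proof. by []. Qed.
Lemma vf_foldE (M N : lmodType k) (F : M -> N -> vectorField) (t : ktens M N) a :
  (kfold F t) a = kfold (fun x y => F x y a) t.
Proof. by apply: (kfold_comp (g := fun u : vectorField => u a)). Qed.
Lemma vf_ractE (u : vectorField) a b : vf_ract u a b = \ksum_(x, y <- Rb) (act x a * hact_fun y u b).
Proof. by rewrite /vf_ract vf_foldE. Qed.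

Lemma vf_equiv : isEquivBimod vf_ops.
Proof.
split=> /=.
- by move=> a b u; apply: vf_ext => c; rewrite vf_addE !vf_lactE mulrDl.
- by move=> a u v; apply: vf_ext => c; rewrite vf_addE !vf_lactE vf_addE mulrDr.
- by move=> a b u; apply: vf_ext => c; rewrite !vf_lactE mulrA.
- by move=> u; apply: vf_ext => c; rewrite !vf_lactE mul1r.
- move=> u v a; apply: vf_ext => b; rewrite vf_addE !vf_ractE -kfold_addf.
  by apply: eq_kfold => x y; rewrite hact_funD mulrDr.
- move=> u a b; apply: vf_ext => c; rewrite vf_addE !vf_ractE -kfold_addf.
  by apply: eq_kfold => x y; rewrite (linD (act_linr _)) mulrDl.
- move=> u a b; apply: vf_ext => c; have [hu _] := vf_der u; rewrite !vf_ractE.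
  under eq_kfold_in do rewrite actMr kfold_mulr.
  rewrite univRV_comull; last by split; lin.
  transitivity (\ksum_(r, s <- Rb) \ksum_(s1, s2 <- comul s) \ksum_(p, q <- Rb)
     (act r b * (act s1 (act p a) * hact_fun (s2 * q) u c))).
    rewrite univRV_comulr; last by split; lin.
    transitivity (\ksum_(r, s <- Rb) \ksum_(p, q <- Rb) (act p a * act r b * hact_fun (s * q) u c)).
      by [].
    transitivity (\ksum_(r', s' <- Rb) \ksum_(p, q <- Rb) (act p a * act r' b * hact_fun (s' * q) u c)); first by [].
    rewrite [RHS]kfold_exch; apply: eq_kfold => r' s'.
    rewrite [RHS]kfold_exch; apply: eq_kfold => p q.
    rewrite (braided_mulC (act p a)) kfold_mulr; apply: eq_kfold => r s.
    by rewrite actMl mulrA.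
  apply: eq_kfold => r s; under eq_kfold_in do rewrite -kfold_mull.
  rewrite -kfold_mull; congr (_ * _).
  rewrite (_ : hact_fun s (vf_ract u a) c =
     hact_fun s (fun c => \ksum_(p, q <- Rb) (act p a * hact_fun q u c)) c); last first.
    by rewrite /hact_fun; apply: eq_kfold => x y; rewrite vf_ractE.
  rewrite hact_fun_fold kfold_exch; apply: eq_kfold => p q.
  rewrite hact_fun_lact; last exact: hact_fun_lin.
  by apply: eq_kfold => s1 s2; rewrite hact_funM.
- move=> u; apply: vf_ext => b; have [hu _] := vf_der u; rewrite vf_ractE.
  have hf : linear (fun x : H => hact_fun x u b) by lin.
  rewrite -[RHS](hact_fun1 hu) -(@univRV_counitl k H) (kfold_lin_comp _ _ hf).
  by apply: eq_kfold => x y; rewrite act1r -scalerAl mul1r (linZ hf).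
- move=> a b u; apply: vf_ext => c; have [hu _] := vf_der u.
  rewrite vf_lactE !vf_ractE.
  transitivity (\ksum_(p, q <- Rb) \ksum_(q1, q2 <- comul q)
     (act p b * (act q1 a * hact_fun q2 u c))).
    by apply: eq_kfold => p q; rewrite hact_fun_lact // kfold_mull.
  rewrite univRV_comulr; last by split; lin.
  rewrite kfold_exch kfold_mull; apply: eq_kfold => p' q'.
  rewrite mulrA (braided_mulC a) kfold_mulr; apply: eq_kfold => p q.
  by rewrite actMl mulrA.
- move=> c u; apply: vf_ext => b; have [hu _] := vf_der u.
  rewrite vf_lactE vf_ractE -scalerAl mul1r.
  have hf : linear (fun x : H => hact_fun x u b) by lin.
  rewrite -[in LHS](hact_fun1 hu) -(@univRV_counitl k H) (kfold_lin_comp _ _ hf).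
  rewrite kfold_scale_out.
  by apply: eq_kfold => x y; rewrite act_base -!scalerAl mul1r (linZ hf) !scalerA mulrC.
- move=> g h u; apply: vf_ext => b; rewrite vf_addE !vf_hactE.
  by have [hu _] := vf_der u; rewrite (linD (hact_fun_linl hu b)).
- by move=> h u v; apply: vf_ext => b; rewrite vf_addE !vf_hactE hact_funD.
- by move=> g h u; apply: vf_ext => b; have [hu _] := vf_der u; rewrite !vf_hactE hact_funM.
- by move=> u; apply: vf_ext => b; have [hu _] := vf_der u; rewrite !vf_hactE hact_fun1.
- move=> c h u; apply: vf_ext => b; have [hu _] := vf_der u.
  by rewrite !(vf_lactE, vf_hactE) (linZ (hact_fun_linl hu b)) -scalerAl mul1r.
- move=> h a u; apply: vf_ext => b; have [hu _] := vf_der u.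
  by rewrite !(vf_lactE, vf_hactE) hact_fun_lact // vf_foldE.
- move=> h u a; apply: vf_ext => b; have [hu _] := vf_der u.
  rewrite vf_hactE vf_foldE.
  rewrite (_ : hact_fun h (vf_ract u a) b =
     hact_fun h (fun c => \ksum_(p, q <- Rb) (act p a * hact_fun q u c)) b); last first.
    by rewrite /hact_fun; apply: eq_kfold => x y; rewrite vf_ractE.
  rewrite hact_fun_fold.
  transitivity (\ksum_(p, q <- Rb) \ksum_(h1, h2 <- comul h)
     (act (h1 * p) a * hact_fun (h2 * q) u b)).
    apply: eq_kfold => p q; rewrite hact_fun_lact; last exact: hact_fun_lin.
    by apply: eq_kfold => x y; rewrite actMl hact_funM.
  rewrite kfold_exch (univRV_cocomm (F := fun x y : H => act x a * hact_fun y u b)); last by lin.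
  rewrite kfold_exch; apply: eq_kfold => x y; rewrite vf_ractE.
  by apply: eq_kfold => p q; rewrite actMl hact_funM.
Qed.
Definition vectorFields : equivBimod A := EquivBimod vf_equiv.
End VectorFields.

Section Dual.
Variables (k : comUnitRingType) (H : hopfAlgType k) (A : hopfModuleAlgType H).
Variable M : equivBimod A.
Let MP := equivBimodP M.

Definition left_form (f : M -> A) : Prop :=
  {morph f : v w / v + w} /\ forall (a : A) (v : M), f (a *> v) = a * f v.

Definition left_forms : {pred M -> A} := fun f => `[< left_form f >].

Fact left_forms_zmod : zmod_closed left_forms.
Proof.
split=> [|f g /asboolP[hf lf] /asboolP[hg lg]]; apply/asboolP; split.
- by move=> v w; rewrite addr0.
- by move=> a v; rewrite mulr0.
- by move=> v w; rewrite !fctE hf hg opprD addrACA.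
- by move=> a v; rewrite !fctE lf lg mulrBr.
Qed.

Record dualElt := DualElt { dual_fun :> M -> A; dual_fun_left : dual_fun \in left_forms }.
HB.instance Definition _ := GRing.isZmodClosed.Build (M -> A) left_forms left_forms_zmod.
HB.instance Definition _ := [isSub for dual_fun].
HB.instance Definition _ := [Choice of dualElt by <:].
HB.instance Definition _ := [SubChoice_isSubZmodule of dualElt by <:].

Lemma dualP (f : dualElt) : left_form f.
Proof. by apply/asboolP; exact: dual_fun_left. Qed.

Definition dual_mk (f : M -> A) (hf : left_form f) : dualElt := @DualElt f (asboolT hf).

Lemma dual_ract_left (f : dualElt) (a : A) : left_form (fun v => f v * a).
Proof.
have [hf lf] := dualP f; split=> [v w|b v]; first by rewrite hf mulrDl.
by rewrite lf mulrA.
Qed.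

Lemma dual_lact_left (a : A) (f : dualElt) : left_form (fun v => f (v <* a)).
Proof.
have [hf lf] := dualP f; split=> [v w|b v]; first by rewrite (ract_addl MP) hf.
by rewrite (lract_assoc MP) lf.
Qed.

Definition dual_hact_fun (h : H) (f : M -> A) (v : M) : A :=
  \ksum_(x, y <- comul h) act y (f (antipodeV x ▷ v)).

Lemma left_form_hact (f : M -> A) (v : M) : left_form f -> linear (fun h : H => f (h ▷ v)).
Proof.
case=> hf lf c g h.
by rewrite (hact_addl MP) hf (hact_scale MP) lf -scalerAl mul1r.
Qed.

Ltac linext ::= rewrite ?act_addl ?act_addr ?antipodeV_lin.

Lemma dual_hact_left (h : H) (f : dualElt) : left_form (dual_hact_fun h f).
Proof.
have [hf lf] := dualP f; split=> [v w|a v].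
  rewrite /dual_hact_fun -kfold_addf; apply: eq_kfold => x y.
  by rewrite (hact_addr MP) hf (linD (act_linr y)).
have hl w : linear (fun h : H => f (h ▷ w)) by apply: left_form_hact.
rewrite /dual_hact_fun.
transitivity (\ksum_(x, y <- comul h) \ksum_(x1, x2 <- comul x) \ksum_(y1, y2 <- comul y)
    (act (y1 * antipodeV x2) a * act y2 (f (antipodeV x1 ▷ v)))).
  apply: eq_kfold => x y; rewrite (hact_lact MP) (kfold_comp _ _ hf).
  under eq_kfold_in do rewrite lf.
  rewrite (@comul_antipodeVE _ _ _ (fun p q => act p a * f (q ▷ v))); last first.
    by split=> [n|m] c p q; rewrite ?act_addl ?hl; lin.
  rewrite (kfold_lin_comp _ _ (act_linr y)); apply: eq_kfold => x1 x2.
  by rewrite actMr; apply: eq_kfold => y1 y2; rewrite actMl.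
have hl2 w y : linear (fun h : H => act y (f (antipodeV h ▷ w))).
  by move=> c p q; rewrite antipodeV_lin hl act_addr.
rewrite coassoc4E; [|by lin..].
rewrite kfold_mull; apply: eq_kfold => x y.
have hf' : linear (fun y : H => a * act y (f (antipodeV x ▷ v))) by lin.
rewrite -[RHS](counitlE y hf'); apply: eq_kfold => w y2.
rewrite -kfold_mulr; have hg : linear (fun z : H => act z a) by lin.
by rewrite -(kfold_lin_comp _ _ hg) antipodeVr act_scalar -scalerAl.
Qed.

Definition dual_ract (f : dualElt) (a : A) : dualElt := dual_mk (dual_ract_left f a).
Definition dual_lact (a : A) (f : dualElt) : dualElt := dual_mk (dual_lact_left a f).
Definition dual_hact (h : H) (f : dualElt) : dualElt := dual_mk (dual_hact_left h f).
Definition dual : bimodOps A := BimodOps dual_lact dual_ract dual_hact.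

Lemma dual_ext (f g : dualElt) : (forall v, f v = g v) -> f = g.
Proof. by move=> h; apply: val_inj; apply: funext. Qed.
Lemma dual_foldE (N N' : lmodType k) (F : N -> N' -> dualElt) (t : ktens N N') v :
  (kfold F t) v = kfold (fun x y => F x y v) t.
Proof. by apply: (kfold_comp (g := fun f : dualElt => f v)). Qed.
Lemma dual_addE (f g : dualElt) v : (f + g) v = f v + g v. Proof. by []. Qed.
Lemma dual_oppE (f : dualElt) v : (- f) v = - f v. Proof. by []. Qed.

Lemma dual_hactD h (f g : dualElt) : dual_hact h (f + g) = dual_hact h f + dual_hact h g.
Proof.
apply: dual_ext => v; rewrite dual_addE /= /dual_hact_fun -kfold_addf.
by apply: eq_kfold => x y; rewrite -(linD (act_linr y)).
Qed.
Lemma dual_lactD a (f g : dualElt) : dual_lact a (f + g) = dual_lact a f + dual_lact a g.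
Proof. exact: dual_ext. Qed.
Lemma dual_ractD (f g : dualElt) a : dual_ract (f + g) a = dual_ract f a + dual_ract g a.
Proof. by apply: dual_ext => v; rewrite dual_addE /= mulrDl. Qed.
End Dual.
Arguments dualElt {k H A}.
Arguments dual {k H A}.

Section OneForms.
Variables (k : comUnitRingType) (H : triangularHopfAlgType k) (A : braidedComAlgType H).
Local Notation Rb := (univRV : ktens H H).
Local Notation X := (vectorFields A).
Local Notation XP := (equivBimodP X).

Lemma eval_left (a : A) : left_form (fun u : X => (u : vectorField A) a).
Proof. by []. Qed.

Definition diff (a : A) : dualElt X := dual_mk (eval_left a).

Definition one_form (w : dualElt X) : Prop :=
  exists s : seq (A * A), w = \sum_(p <- s) dual_lact p.1 (diff p.2).

Definition one_forms : {pred dualElt X} := fun w => `[< one_form w >].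

Fact one_forms_zmod : zmod_closed one_forms.
Proof.
split=> [|w w' /asboolP[s ->] /asboolP[s' ->]]; apply/asboolP.
  by exists [::]; rewrite big_nil.
exists (s ++ [seq (- p.1, p.2) | p <- s']); rewrite big_cat big_map /= -sumrN.
congr (_ + _); apply: eq_bigr => p _; apply: dual_ext => u.
have r0 : u <* (0 : A) = 0 by apply: (addrI (u <* (0 : A))); rewrite -(ract_addr XP) !addr0.
have rN : u <* (- p.1) = - (u <* p.1).
  by apply: (addIr (u <* p.1)); rewrite -(ract_addr XP) !addNr.
by rewrite dual_oppE /= [vf_ract u (- p.1)]rN.
Qed.
HB.instance Definition _ := GRing.isZmodClosed.Build (dualElt X) one_forms one_forms_zmod.

Lemma one_forms_gen a b : dual_lact a (diff b) \in one_forms.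
Proof. by apply/asboolP; exists [:: (a, b)]; rewrite big_seq1. Qed.

Lemma one_forms_ind (P : dualElt X -> dualElt X) :
  {morph P : x y / x + y} -> (forall a b, P (dual_lact a (diff b)) \in one_forms) ->
  forall w, w \in one_forms -> P w \in one_forms.
Proof.
move=> hP hg w /asboolP[s ->]; rewrite (big_morph P hP (_ : P 0 = 0)).
  by apply: rpred_sum => p _.
by apply: (addrI (P 0)); rewrite -hP !addr0.
Qed.

Lemma one_forms_lact a w : w \in one_forms -> dual_lact a w \in one_forms.
Proof.
apply: one_forms_ind => [x y|b c]; first exact: dual_lactD.
rewrite (_ : dual_lact a _ = dual_lact (a * b) (diff c)) ?one_forms_gen //.
by apply: dual_ext => u /=; rewrite [vf_ract u (a * b)](ract_mul XP u a b).
Qed.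

Lemma one_forms_ract w a : w \in one_forms -> dual_ract w a \in one_forms.
Proof.
apply: (@one_forms_ind (fun w => dual_ract w a)) => [x y|b c]; first exact: dual_ractD.
rewrite (_ : dual_ract _ a = dual_lact b (diff (c * a)) - dual_lact (b * c) (diff a)).
  by rewrite rpredB ?one_forms_gen.
apply: dual_ext => u; rewrite dual_addE dual_oppE /=.
rewrite [vf_ract u (b * c)](ract_mul XP u b c) /= [X in _ - X]vf_ractE.
by have [_ ->] := vf_der (vf_ract u b); rewrite addrK.
Qed.

Ltac linext ::= rewrite ?act_addl ?act_addr ?hact_fun_linE ?hact_fun_linrE ?antipodeV_lin //.

Lemma one_forms_hact h w : w \in one_forms -> dual_hact h w \in one_forms.
Proof.
apply: one_forms_ind => [x y|a b]; first exact: dual_hactD.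
rewrite (_ : dual_hact h _ = \ksum_(x, y <- comul h) dual_lact (act x a) (diff (act y b))).
  by apply: rpred_sum => p _; apply: one_forms_gen.
apply: dual_ext => u; have [hu _] := vf_der u; rewrite dual_foldE /= /dual_hact_fun /=.
pose G (t z y : H) := \ksum_(p, q <- Rb) (act p (act z a) * hact_fun (q * t) u (act y b)).
have hG1 z y : linear (fun t => G t z y) by rewrite /G; lin.
have hG2 t y : linear (fun z => G t z y) by rewrite /G; lin.
have hG3 t z : linear (G t z) by rewrite /G; lin.
transitivity (\ksum_(x, y <- comul h) \ksum_(y1, y2 <- comul y) \ksum_(z1, z2 <- comul y1)
   G (z1 * antipodeV x) z2 y2).
  apply: eq_kfold => x y.
  have [hw _] := vf_der (vf_ract (vf_hact (antipodeV x) u) a).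
  rewrite (hact_fun_ev hw); apply: eq_kfold => y1 y2.
  rewrite -vf_hactE [vf_hact y1 _](hact_ract XP y1 (vf_hact (antipodeV x) u) a) vf_foldE.
  apply: eq_kfold => z1 z2; rewrite /= vf_ractE; apply: eq_kfold => p q.
  by rewrite mulrA !hact_funM //; exact: hact_fun_lin.
transitivity (\ksum_(m, y2 <- comul h) \ksum_(n, z2 <- comul m) \ksum_(x, z1 <- comul n)
   G (z1 * antipodeV x) z2 y2).
  rewrite -coassocE; [|by lin..].
  by apply: eq_kfold => m y2; rewrite -coassocE; [|by lin..].
apply: eq_kfold => m y2; rewrite vf_ractE.
have hl : linear (fun z : H => G 1 z y2) by apply: hG2.
transitivity (G 1 m y2); last by rewrite /G; apply: eq_kfold => p q; rewrite mulr1.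
rewrite -[RHS](counitlE m hl); apply: eq_kfold => n z2.
have hg : linear (fun t : H => G t z2 y2) by apply: hG1.
by rewrite -(kfold_lin_comp _ _ hg) antipodeVr (linZ hg).
Qed.

Record oneForm := OneForm { oneForm_val :> dualElt X; oneFormP : oneForm_val \in one_forms }.
HB.instance Definition _ := [isSub for oneForm_val].
HB.instance Definition _ := [Choice of oneForm by <:].
HB.instance Definition _ := [SubChoice_isSubZmodule of oneForm by <:].

Definition of_lact (a : A) (w : oneForm) : oneForm := OneForm (one_forms_lact a (oneFormP w)).
Definition of_ract (w : oneForm) (a : A) : oneForm := OneForm (one_forms_ract a (oneFormP w)).
Definition of_hact (h : H) (w : oneForm) : oneForm := OneForm (one_forms_hact h (oneFormP w)).
Definition oneForms : bimodOps A := BimodOps of_lact of_ract of_hact.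

Lemma diff_one_form (a : A) : diff a \in one_forms.
Proof.
rewrite (_ : diff a = dual_lact 1 (diff a)) ?one_forms_gen //.
by apply: dual_ext => u /=; rewrite [vf_ract u 1](ract_one XP u).
Qed.
Definition exd0 (a : A) : oneForms := OneForm (diff_one_form a).
End OneForms.

Definition char0_field (K : comUnitRingType) : Prop :=
  GRing.field_axiom K /\ [pchar K] =i pred0.

(* coef f n is the coefficient of the n-th power of the variable in f. *)
Definition power_series_ring (K k : comUnitRingType) : Prop :=
  exists coef : k -> nat -> K,
    [/\ bijective coef,
        forall f g n, coef (f + g) n = coef f n + coef g n,
        forall n, coef 1 n = (n == 0)%N%:R
      & forall f g n, coef (f * g) n = \sum_(i < n.+1) coef f i * coef g (n - i)%N].

Definition base_ring (k : comUnitRingType) : Prop :=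
  char0_field k \/ exists K : comUnitRingType, char0_field K /\ power_series_ring K k.

Section ModuleNotions.
Variables (k : comUnitRingType) (H : hopfAlgType k) (A : hopfModuleAlgType H).
Implicit Types (M N : bimodOps A).

Definition left_linear M (Q : lmodType A) (f : M -> Q) : Prop :=
  {morph f : v w / v + w} /\ forall (a : A) (v : M), f (a *> v) = a *: f v.

Definition finitely_generated M : Prop :=
  exists (n : nat) (e : 'I_n -> M), forall v : M, exists c : 'I_n -> A,
    v = \sum_(i < n) c i *> e i.

Definition projective M : Prop :=
  forall (P Q : lmodType A) (g : {linear P -> Q}) (f : M -> Q),
    left_linear f -> (forall q, exists p, g p = q) ->
    exists f' : M -> P, left_linear f' /\ forall v, g (f' v) = f v.

Definition fg_projective M : Prop := finitely_generated M /\ projective M.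

Definition base_linear M N (f : M -> N) : Prop :=
  {morph f : v w / v + w} /\ forall (c : k) (v : M), f (c%:A *> v) = c%:A *> f v.

Definition tensA_sort M N : Type := tens (@ract k H A M) (@lact k H A N).
HB.instance Definition _ M N := GRing.Zmodule.on (tensA_sort M N).

Definition tensA_mk M N (v : M) (w : N) : tensA_sort M N := tmk v w.
Definition tensA_fold M N (P : zmodType) (t : tensA_sort M N) (f : M -> N -> P) : P :=
  tfold f t.

End ModuleNotions.
Arguments tensA_mk {k H A M N}.
Arguments tensA_fold {k H A M N P}.

Reserved Notation "\tsum_ ( x , y <- t ) F"
  (at level 36, x, y at level 1, t at level 100, F at level 36,
   format "'[' \tsum_ ( x ,  y  <-  t ) '/  '  F ']'").
Notation "\tsum_ ( x , y <- t ) F" := (tensA_fold t (fun x y => F)) : ring_scope.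
Notation "v ⊗A w" := (tensA_mk v w) (at level 38, no associativity) : ring_scope.

Section TensorBimodule.
Variables (k : comUnitRingType) (H : hopfAlgType k) (A : hopfModuleAlgType H).
Variables M N : bimodOps A.

Definition tensA : bimodOps A := @BimodOps k H A (tensA_sort M N)
  (fun a t => \tsum_(v, w <- t) ((a *> v) ⊗A w))
  (fun t a => \tsum_(v, w <- t) (v ⊗A (w <* a)))
  (fun h t => \tsum_(v, w <- t) \ksum_(x, y <- comul h) ((x ▷ v) ⊗A (y ▷ w))).

End TensorBimodule.

Section Braiding.
Variables (k : comUnitRingType) (H : triangularHopfAlgType k) (A : hopfModuleAlgType H).
Implicit Types (M N : bimodOps A).
Local Notation Rb := (univRV : ktens H H).

Definition symmetric_bimod M : Prop :=
  forall (a : A) (v : M), a *> v = \ksum_(x, y <- Rb) ((x ▷ v) <* act y a).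

Definition braid M N (t : tensA M N) : tensA N M :=
  \tsum_(v, w <- t) \ksum_(x, y <- Rb) ((x ▷ w) ⊗A (y ▷ v)).

End Braiding.

Section Cartan.
Variables (k : comUnitRingType) (H : triangularHopfAlgType k) (A : braidedComAlgType H).
Local Notation Rb := (univRV : ktens H H).
Local Notation X := (vectorFields A).
Local Notation Omega := (oneForms A).

Definition wedge_vf (u v : X) : tensA X X :=
  u ⊗A v - \ksum_(x, y <- Rb) ((x ▷ v) ⊗A (y ▷ u)).

(* The antisymmetrizer A_2: the permutations of two letters are the identity and
   the transposition, which acts by the braiding. *)
Definition antisym2 (t : tensA Omega Omega) : tensA Omega Omega :=
  ((2`!%:R)^-1)%:A *> (t - braid t).

Definition two_form (t : tensA Omega Omega) : Prop := exists t', t = antisym2 t'.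

(* The general factor (r + r')! / (r! r'!) at r = r' = 1. *)
Definition wedge (w w' : Omega) : tensA Omega Omega :=
  ((1 + 1)`!%:R / (1`!%:R * 1`!%:R))%:A *> antisym2 (w ⊗A w').

(* d is the degree-one component of the extension of exd0 to an H-equivariant
   differential of forms: the clauses are those conditions on the extension that
   involve forms of degree at most one. They determine d, because one-forms are
   sums of products a *> exd0 b. *)
Record exterior_derivative (d : Omega -> tensA Omega Omega) : Prop := {
  exd_linear : base_linear d;
  exd_equivariant : forall (h : H) (w : Omega), d (h ▷ w) = h ▷ d w;
  exd_two_form : forall w : Omega, two_form (d w);
  exd_exd : forall a : A, d (exd0 a) = 0;
  exd_leibnizl : forall (a : A) (w : Omega), d (a *> w) = wedge (exd0 a) w + a *> d w;
  exd_leibnizr : forall (w : Omega) (a : A), d (w <* a) = d w <* a - wedge w (exd0 a)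
}.

Variable Gamma : equivBimod A.
Local Notation Gamma' := (dual Gamma).

Definition left_connection (nabla : Gamma -> tensA Omega Gamma) : Prop :=
  base_linear nabla /\
  forall (a : A) (s : Gamma), nabla (a *> s) = exd0 a ⊗A s + a *> nabla s.

Definition pairing (s : Gamma) (sigma : Gamma') : A := sigma s.
Definition pairing_vf (u : X) (w : Omega) : A := w u.

Definition interior (u : X) (t : tensA Omega Gamma) : Gamma :=
  \tsum_(w, s <- t) (pairing_vf u w *> s).

Definition covariant (nabla : Gamma -> tensA Omega Gamma) (u : X) (s : Gamma) : Gamma :=
  interior u (nabla s).

Definition curvature (nabla : Gamma -> tensA Omega Gamma) (u v : X) (s : Gamma) : Gamma :=
  covariant nabla u (covariant nabla v s)
  - \ksum_(x, y <- Rb) covariant nabla (x ▷ v) (covariant nabla (y ▷ u) s)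
  - covariant nabla (vf_bracket u v) s.

Definition pairing_l (t : tensA Omega Gamma) (sigma : Gamma') : Omega :=
  \tsum_(w, s <- t) (w <* pairing s sigma).
Definition pairing_r (s : Gamma) (t : tensA Gamma' Omega) : Omega :=
  \tsum_(sigma, w <- t) (pairing s sigma *> w).

Definition dual_connection (nabla : Gamma -> tensA Omega Gamma)
    (nabla' : Gamma' -> tensA Gamma' Omega) : Prop :=
  forall (s : Gamma) (sigma : Gamma'),
    exd0 (pairing s sigma) = pairing_l (nabla s) sigma + pairing_r s (nabla' sigma).

Definition wedge_r (t : tensA Gamma' Omega) (w : Omega) : tensA Gamma' (tensA Omega Omega) :=
  \tsum_(sigma, w' <- t) (sigma ⊗A wedge w' w).

(* d_{*nabla} on *Gamma ⊗ Omega; on *Gamma itself it is nabla'. *)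
Definition exd_connection (d : Omega -> tensA Omega Omega)
    (nabla' : Gamma' -> tensA Gamma' Omega) (t : tensA Gamma' Omega) :
    tensA Gamma' (tensA Omega Omega) :=
  \tsum_(sigma, w <- t) (wedge_r (nabla' sigma) w + sigma ⊗A d w).

Definition exd_connection_sq (d : Omega -> tensA Omega Omega)
    (nabla' : Gamma' -> tensA Gamma' Omega) (sigma : Gamma') :
    tensA Gamma' (tensA Omega Omega) :=
  exd_connection d nabla' (nabla' sigma).

Definition pairing3 (z : tensA (tensA X X) Gamma) (t : tensA Gamma' (tensA Omega Omega)) : A :=
  \tsum_(uv, s <- z) \tsum_(u, v <- uv) \tsum_(sigma, ww <- t) \tsum_(w1, w2 <- ww)
    pairing_vf u (pairing_vf v (pairing s sigma *> w1) *> w2).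

End Cartan.
Arguments curvature {k H A Gamma}.
Arguments pairing3 {k H A Gamma}.

(* Main.v *)
Require Import Defs.
From mathcomp Require Import all_boot all_order all_algebra.
From mathcomp Require Import boolp ssrAC.
Import GRing.Theory.
Local Open Scope ring_scope.

(** Write [dual]-pairings as evaluations, so that a form [w] at a vector field
    [u] is [w u], and let [Rbar = sum x ⊗ y] be the inverse R-matrix. Choose a
    presentation [nabla' sigma = sum_i sigma_i ⊗ w_i], and presentations
    [nabla' sigma_i = sum_j sigma_ij ⊗ w_ij].

    Evaluating the relation that defines the dual connection at [u] gives
    [sigma (nabla_u s) = u (sigma s) - sum_i w_i (u <* sigma_i s)]
    ([pairing_covariant]). Using it twice ([pairing_covariant2]),
    [sigma (nabla_u nabla_v s)] is [u (v (sigma s))] minus the sum over [i] of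
    [u (w_i (v <* sigma_i s)) + w_i (u <* v (sigma_i s))
     - sum_j w_i (u <* w_ij (v <* sigma_ij s))].
    In the curvature the terms that differentiate [sigma s] twice cancel against
    the bracket. What remains is a sum over [i], and it is matched summand by
    summand with the contraction of
    [sum_ij sigma_ij ⊗ (w_ij ∧ w_i) + sum_i sigma_i ⊗ d w_i], the square of the
    exterior derivative of the dual connection at [sigma].

    Two facts on forms do this. First, contracting with [u ⊗ v] turns the
    braiding of forms into the braiding of vector fields ([braid_pairing],
    [contract2_braid]); hence the contraction of [w1 ∧ w2] with [u ⊗ v] is
    [w2 (u <* w1 v)] minus its braided transpose ([contract2_wedge]), which
    accounts for the double sums. Second, Cartan's formula
    [contraction of d w = - u (w v) + sum (x▷v) (w (y▷u)) + w [u, v]]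
    ([cartan_formula]), which only has to be checked on [w = a db], where it is
    the braided Leibniz rule ([cartan_exact]). It is applied to
    [a *> d w = d (a *> w) - da ∧ w] with [a = sigma_i s]: the term in [da ∧ w]
    produces exactly the summands [w_i (u <* v (sigma_i s))] above
    ([contract2_exd_ract]).

    For the form with [u ∧ v], contraction with [u ⊗ v] of an antisymmetrized
    tensor changes sign under the braided exchange of [u] and [v], because
    [Rbar] composed with its flip is the identity ([univRV_swapK]). So the
    contraction with [u ∧ v] is twice the contraction with [u ⊗ v], and [2] is
    invertible in [k] ([base_ring_unit2]). *)

Set Implicit Arguments.
Unset Strict Implicit.
Unset Printing Implicit Defensive.

(** * The base ring *)

(** In a power series ring the inverse of [2] is the constant series with value
    the inverse of [2] in the field of coefficients. *)
Lemma base_ring_unit2 (k : comUnitRingType) : base_ring k -> (2 : k) \is a GRing.unit.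
Proof.
have unit2 (K : comUnitRingType) : char0_field K -> (2 : K) \is a GRing.unit.
  case=> hF hchar; apply: hF; apply/negP => h2.
  by have := hchar 2%N; rewrite inE /= h2.
case=> [/unit2 //|[K [/unit2 hK [coef [[g gK coefK] coefD coef1 _]]]]].
apply/unitrPr; exists (g (fun n => (n == 0)%N%:R / 2)).
apply: (can_inj gK); apply: funext => n.
rewrite mulr_natl mulr2n coefD coefK coef1 -mulrDr.
by rewrite -[_ + _^-1]mulr2n -[_^-1 *+ 2]mulr_natr mulVr ?mulr1 //.
Qed.

(** * Folds over balanced tensor products *)

Section Folds.
Variables (S : Type) (M N : zmodType) (r : M -> S -> M) (l : S -> N -> N).

Lemma tfold_addf (P : zmodType) (f g : M -> N -> P) (t : tens r l) :
  tfold (fun m n => f m n + g m n) t = tfold f t + tfold g t.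
Proof. exact: big_split. Qed.

Lemma tfold_oppf (P : zmodType) (f : M -> N -> P) (t : tens r l) :
  tfold (fun m n => - f m n) t = - tfold f t.
Proof. exact: sumrN. Qed.

Lemma kfold_oppf (k : comUnitRingType) (M' N' : lmodType k) (P : zmodType)
    (f : M' -> N' -> P) (t : ktens M' N') :
  kfold (fun m n => - f m n) t = - kfold f t.
Proof. exact: sumrN. Qed.

Lemma kfold_tfold_exch (k : comUnitRingType) (M' N' : lmodType k) (P : zmodType)
    (F : M' -> N' -> M -> N -> P) (t : ktens M' N') (z : tens r l) :
  kfold (fun x y => tfold (F x y) z) t = tfold (fun m n => kfold (fun x y => F x y m n) t) z.
Proof. exact: exchange_big. Qed.

Lemma tfold_linear (k : comUnitRingType) (P Q : lmodType k) (F : P -> M -> N -> Q)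
    (t : tens r l) :
  (forall m n, linear (fun x => F x m n)) -> linear (fun x => tfold (F x) t).
Proof.
move=> hF c x y; rewrite /tfold /fsum scaler_sumr -big_split.
by apply: eq_bigr => p _; apply: hF.
Qed.

End Folds.

(** * The action of a Hopf algebra on left linear forms *)

Section EquivariantForms.
Variables (k : comUnitRingType) (H : hopfAlgType k) (A : hopfModuleAlgType H).
Variable M : equivBimod A.
Implicit Types (g h : H) (v : M) (f : dualElt M).

Lemma formN f v : f (- v) = - f v.
Proof.
have [fD _] := dualP f; have f0 : f 0 = 0 by apply: (addrI (f 0)); rewrite -fD !addr0.
by apply: (addIr (f v)); rewrite -fD !addNr f0.
Qed.

Lemma form_hact_lin f v : linear (fun h => f (h ▷ v)).
Proof. exact: left_form_hact (dualP f). Qed.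

Ltac linext ::= rewrite ?act_addl ?act_addr ?antipodeV_lin ?form_hact_lin.

Lemma hact_form_lin f v : linear (fun h => dual_hact h f v).
Proof.
have hb : bilin (fun x y : H => act y (f (antipodeV x ▷ v))) by split; lin.
by move=> c g h; rewrite /= /dual_hact_fun linearP (kfold_lin hb).
Qed.

Lemma hact_formM g h f v : dual_hact (g * h) f v = dual_hact g (dual_hact h f) v.
Proof.
rewrite /= /dual_hact_fun comulME; last by split; lin.
apply: eq_kfold => x y; rewrite (kfold_lin_comp _ _ (act_linr y)).
by apply: eq_kfold => x' y'; rewrite antipodeVM actMl (hact_mul (equivBimodP M)).
Qed.

(** Equivariance of the evaluation: the factor [S^-1] in the action on forms is
    there to cancel [h_(1)] acting on the argument. *)
Lemma act_pairing h f v :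
  act h (f v) = \ksum_(x, y <- comul h) dual_hact y f (x ▷ v).
Proof.
have MP := equivBimodP M.
transitivity (\ksum_(x, y <- comul h) \ksum_(y1, y2 <- comul y)
   act y2 (f ((antipodeV y1 * x) ▷ v))); last first.
  apply: eq_kfold => x y; apply: eq_kfold => y1 y2.
  by rewrite (hact_mul MP).
rewrite -coassocE; [|by lin..].
have hf : linear (fun y : H => act y (f v)) by lin.
rewrite -(counitlE h hf); apply: eq_kfold => x y.
have hg : linear (fun z : H => act y (f (z ▷ v))) by lin.
rewrite -(kfold_lin_comp _ _ hg) antipodeVl (linZ hg).
by rewrite (hact_one MP).
Qed.

End EquivariantForms.

(** * Evaluating one-forms on vector fields *)

Section FormsOnVectorFields.
Variables (k : comUnitRingType) (H : triangularHopfAlgType k) (A : braidedComAlgType H).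
Local Notation Rb := (univRV : ktens H H).
Local Notation X := (vectorFields A).
Local Notation XP := (equivBimodP X).
Implicit Types (u v : X) (w : dualElt X) (a b : A).

Lemma form_ract w u a : w (u <* a) = \ksum_(x, y <- Rb) (act x a * w (y ▷ u)).
Proof.
have [wD wZ] := dualP w.
rewrite [_ <* _]/(vf_ract u a) /vf_ract (kfold_comp _ _ wD).
by apply: eq_kfold => x y; apply: wZ.
Qed.

(** The braided exchange of two vector fields is an involution, as the category
    of modules over a triangular Hopf algebra is symmetric. *)
Lemma univRV_swapK (P : lmodType k) (F : X -> X -> P) u v :
  bilin (fun g h : H => F (g ▷ u) (h ▷ v)) ->
  \ksum_(x, y <- Rb) \ksum_(x', y' <- Rb) F (x' ▷ (y ▷ u)) (y' ▷ (x ▷ v)) = F u v.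
Proof.
move=> hF; rewrite kfold_exch.
transitivity (F ((1 : H) ▷ u) ((1 : H) ▷ v)); last by rewrite !(hact_one XP).
rewrite -(univRV_flip hF); apply: eq_kfold => p q; apply: eq_kfold => p' q'.
by rewrite !(hact_mul XP).
Qed.

Ltac linext ::= rewrite ?act_addl ?act_addr ?form_hact_lin ?hact_form_lin.

(** Both sides equal the sum of the [(x ▷ w1) u * w2 (y ▷ v)]. The right-hand
    side takes this form once the scalar [w1 (y ▷ u)] is moved to the left of
    [x ▷ v], the left-hand side by braided commutativity of [A]. Either way
    expanding the action on a value leaves a surplus copy of [Rbar] next to its
    flip, and the two cancel. *)
Lemma braid_pairing w1 w2 u v :
  \ksum_(x, y <- Rb) dual_hact y w1 (u <* dual_hact x w2 v)
  = \ksum_(x, y <- Rb) w2 ((x ▷ v) <* w1 (y ▷ u)).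
Proof.
transitivity (\ksum_(x, y <- Rb) (dual_hact x w1 u * w2 (y ▷ v))).
  symmetry.
  transitivity (\ksum_(x, y <- Rb) \ksum_(p, q <- Rb) \ksum_(r, s <- Rb) \ksum_(p', q' <- Rb)
     (act r (dual_hact p w2 ((p' * y) ▷ v)) * dual_hact (q * (q' * x)) w1 (s ▷ u))).
    apply: eq_kfold => x y; rewrite braided_mulC.
    transitivity (\ksum_(r, s <- Rb) \ksum_(s1, s2 <- comul s)
       (act r (w2 (y ▷ v)) * dual_hact (s2 * x) w1 (s1 ▷ u))).
      apply: eq_kfold => r s; rewrite (act_pairing s) kfold_mull.
      by apply: eq_kfold => s1 s2; rewrite hact_formM.
    rewrite (univRV_comulr (F := fun r s1 s2 =>
      act r (w2 (y ▷ v)) * dual_hact (s2 * x) w1 (s1 ▷ u))); last by split; lin.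
    rewrite [RHS]kfold_exch; apply: eq_kfold => r s.
    transitivity (\ksum_(p, q <- Rb) \ksum_(p1, p2 <- comul p)
       (act r (dual_hact p2 w2 ((p1 * y) ▷ v)) * dual_hact (q * x) w1 (s ▷ u))).
      apply: eq_kfold => p q.
      rewrite actMl act_pairing (kfold_lin_comp _ _ (act_linr r)) kfold_mulr.
      by apply: eq_kfold => p1 p2; rewrite (hact_mul XP).
    rewrite (univRV_comull (F := fun p1 p2 q =>
      act r (dual_hact p2 w2 ((p1 * y) ▷ v)) * dual_hact (q * x) w1 (s ▷ u))).
      by apply: eq_kfold => p q; apply: eq_kfold => p' q'; rewrite mulrA.
    by split; lin.
  rewrite kfold_exch; apply: eq_kfold => p q.
  rewrite form_ract kfold_exch; apply: eq_kfold => r s.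
  rewrite kfold_exch.
  rewrite (univRV_flip (F := fun g h =>
    act r (dual_hact p w2 (g ▷ v)) * dual_hact (q * h) w1 (s ▷ u))); last by lin.
  by rewrite mulr1 (hact_one XP).
transitivity (\ksum_(x, y <- Rb) \ksum_(p, q <- Rb) \ksum_(p', q' <- Rb)
   (dual_hact p w1 ((p' * y) ▷ u) * w2 ((q * (q' * x)) ▷ v))).
  rewrite kfold_exch; apply: eq_kfold => p q.
  rewrite kfold_exch.
  rewrite (univRV_flip (F := fun g h =>
    dual_hact p w1 (g ▷ u) * w2 ((q * h) ▷ v))); last by lin.
  by rewrite mulr1 (hact_one XP).
apply: eq_kfold => x y; rewrite form_ract.
transitivity (\ksum_(p, q <- Rb) \ksum_(p1, p2 <- comul p)
   (dual_hact p2 w1 ((p1 * y) ▷ u) * w2 ((q * x) ▷ v))).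
  rewrite (univRV_comull (F := fun p1 p2 q =>
    dual_hact p2 w1 ((p1 * y) ▷ u) * w2 ((q * x) ▷ v))); last by split; lin.
  by under [in RHS]eq_kfold_in do under eq_kfold_in do rewrite -mulrA.
apply: eq_kfold => p q; rewrite act_pairing kfold_mulr.
by apply: eq_kfold => p1 p2; rewrite !(hact_mul XP).
Qed.

Lemma form_ractl_lin w u a : linear (fun h : H => w ((h ▷ u) <* a)).
Proof. exact: form_hact_lin (dual_lact a w) u. Qed.

Lemma form_ractr_lin w u : linear (fun a => w (u <* a)).
Proof. by move=> c a b; rewrite !form_ract; lin. Qed.

(** Linearity of the braiding over [A]: a scalar on the right of the first factor
    comes out on the right of the second one. *)
Lemma swap_ract w1 w2 u v a :
  \ksum_(x, y <- Rb) w2 ((x ▷ v) <* w1 ((y ▷ u) <* a))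
  = \ksum_(x, y <- Rb) w2 ((x ▷ (v <* a)) <* w1 (y ▷ u)).
Proof.
Ltac linext ::= rewrite ?act_addl ?act_addr ?form_hact_lin ?form_ractl_lin ?form_ractr_lin //.
have [w2D _] := dualP w2.
transitivity (\ksum_(x, y <- Rb) \ksum_(x1, x2 <- comul x)
   w2 ((x1 ▷ v) <* (act x2 a * w1 (y ▷ u)))); last first.
  apply: eq_kfold => x y.
  rewrite (hact_ract XP) (kfold_comp (g := fun z : X => w2 (z <* w1 (y ▷ u)))).
    by apply: eq_kfold => x1 x2; rewrite (ract_mul XP).
  by move=> z z'; rewrite (ract_addl XP) w2D.
rewrite (univRV_comull (F := fun x1 x2 y =>
  w2 ((x1 ▷ v) <* (act x2 a * w1 (y ▷ u))))); last by split; lin.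
rewrite kfold_exch; apply: eq_kfold => x y.
rewrite (form_ract w1) (kfold_lin_comp _ _ (form_ractr_lin _ _)).
by apply: eq_kfold => p q; rewrite (hact_mul XP).
Qed.

(** * Cartan's formula for the forms [a db] *)

Lemma vf_lin u : linear u.
Proof. by have [] := vf_der u. Qed.

(** The braided Leibniz rule splits [u ((v <* a) b)] into a part in which [u]
    differentiates [a], [leibniz_left], and a part in which it differentiates
    [v b], [leibniz_right]. *)
Definition leibniz_left a b u v : A := \ksum_(p, q <- Rb) (u (act p a) * (q ▷ v : X) b).
Definition leibniz_right a b u v : A :=
  \ksum_(p, q <- Rb) (act p a * hact_fun q (fun c => u (v c)) b).

Ltac linext ::= rewrite ?act_addl ?act_addr ?hact_fun_linE ?hact_fun_linrE //.

Lemma comp_ract u v a b :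
  u ((v <* a : X) b) = leibniz_left a b u v + leibniz_right a b u v.
Proof.
have hu := vf_lin u; have hv := vf_lin v; have [_ du] := vf_der u.
rewrite [in LHS]/ract /= vf_ractE (kfold_lin_comp _ _ hu).
under eq_kfold_in do rewrite du.
rewrite kfold_addf; congr (_ + _).
rewrite /leibniz_right; under [in RHS]eq_kfold_in do rewrite hact_fun_comp // kfold_mull.
rewrite univRV_comulr; last by split; lin.
by rewrite kfold_exch; apply: eq_kfold => p q; apply: eq_kfold => p' q'; rewrite actMl.
Qed.

Lemma ract_der u v a b :
  (u <* v a : X) b = \ksum_(x, y <- Rb) leibniz_left a b (x ▷ v) (y ▷ u).
Proof.
have hu := vf_lin u; have hv := vf_lin v.
rewrite [in LHS]/ract /= vf_ractE.
under eq_kfold_in do rewrite hact_fun_ev // kfold_mulr.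
rewrite univRV_comull; last by split; lin.
rewrite kfold_exch; apply: eq_kfold => p q; apply: eq_kfold => p' q'.
by rewrite /= hact_funM.
Qed.

Lemma bracket_ract u v a b :
  ((vf_bracket u v : X) <* a : X) b
  = leibniz_right a b u v - \ksum_(x, y <- Rb) leibniz_right a b (x ▷ v) (y ▷ u).
Proof.
rewrite [in LHS]/ract /= vf_ractE /leibniz_right kfold_exch -kfold_oppf.
rewrite -kfold_addf; apply: eq_kfold => p q.
by rewrite -kfold_mull -mulrBr -hact_fun_fold -hact_funN -hact_funD.
Qed.

(** The left-hand side is the contraction of [da ∧ db] with [u ⊗ v], and
    [(v <* a) b] is the value of [a db] at [v]. The parts [leibniz_right] of the
    two compositions cancel against the bracket. *)
Lemma cartan_exact u v a b :
  (u <* v a : X) b - \ksum_(x, y <- Rb) ((x ▷ v) <* (y ▷ u : X) a : X) b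
  = - u ((v <* a : X) b) + \ksum_(x, y <- Rb) (x ▷ v : X) (((y ▷ u) <* a : X) b)
    + ((vf_bracket u v : X) <* a : X) b.
Proof.
have hu := vf_lin u; have hv := vf_lin v.
under [X in _ - X]eq_kfold_in do rewrite ract_der.
have hM q : linear (fun h : H => hact_fun q (hact_fun h v) b).
  by move=> c g h; rewrite -!hact_funM // mulrDr -scalerAr hact_fun_linE.
rewrite univRV_swapK; last by rewrite /leibniz_left /=; lin.
rewrite ract_der bracket_ract comp_ract.
under [X in - _ + X + _]eq_kfold_in do rewrite comp_ract.
rewrite kfold_addf.
by rewrite [RHS]addrACA addrK opprD addrNK addrC.
Qed.

End FormsOnVectorFields.

(** * Contraction of two-forms with pairs of vector fields *)

Section Contraction.
Variables (k : comUnitRingType) (H : triangularHopfAlgType k) (A : braidedComAlgType H).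
Local Notation Rb := (univRV : ktens H H).
Local Notation X := (vectorFields A).
Local Notation XP := (equivBimodP X).
Local Notation Omega := (oneForms A).
Implicit Types (u v : X) (w : Omega) (a b : A) (z : tensA Omega Omega).

(** The pairing of [u ⊗ v] with [w1 ⊗ w2] nests: [v] is paired with [w1], and the
    resulting scalar multiplies [w2] before the pairing with [u]. *)
Definition contract2 u v z : A :=
  \tsum_(w1, w2 <- z) (w2 : dualElt X) (u <* (w1 : dualElt X) v).

Lemma contract2_balanced u v :
  balanced (@ract _ _ _ Omega) (@lact _ _ _ Omega)
    (fun w1 w2 : Omega => (w2 : dualElt X) (u <* (w1 : dualElt X) v)).
Proof.
split=> [w2 w1 w1'|w1 w2 w2'|w1 a w2] //.
  by have [w2D _] := dualP (w2 : dualElt X); rewrite -w2D -(ract_addr XP).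
exact: (congr1 (dual_fun (w2 : dualElt X)) (ract_mul XP u ((w1 : dualElt X) v) a)).
Qed.

Lemma contract2_mk u v w1 w2 :
  contract2 u v (w1 ⊗A w2) = (w2 : dualElt X) (u <* (w1 : dualElt X) v).
Proof. exact: tfold_tmk (contract2_balanced u v). Qed.

Lemma contract2D u v : {morph contract2 u v : z z' / z + z'}.
Proof. exact: tfoldD (contract2_balanced u v). Qed.

Lemma contract2_0 u v : contract2 u v 0 = 0.
Proof. by apply: (addrI (contract2 u v 0)); rewrite -contract2D !addr0. Qed.

Lemma contract2N u v z : contract2 u v (- z) = - contract2 u v z.
Proof. by apply: (addIr (contract2 u v z)); rewrite -contract2D !addNr contract2_0. Qed.

Lemma contract2_addl u u' v z : contract2 (u + u') v z = contract2 u v z + contract2 u' v z.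
Proof.
rewrite -[RHS]tfold_addf; apply: eq_tfold => w1 w2.
by have [w2D _] := dualP (w2 : dualElt X); rewrite (ract_addl XP) w2D.
Qed.

Lemma contract2_addr u v v' z : contract2 u (v + v') z = contract2 u v z + contract2 u v' z.
Proof.
rewrite -[RHS]tfold_addf; apply: eq_tfold => w1 w2.
have [w1D _] := dualP (w1 : dualElt X); have [w2D _] := dualP (w2 : dualElt X).
by rewrite w1D (ract_addr XP) w2D.
Qed.

Lemma contract2_middle u v a z : contract2 (u <* a) v z = contract2 u (a *> v) z.
Proof.
apply: eq_tfold => w1 w2.
by have [_ w1Z] := dualP (w1 : dualElt X); rewrite w1Z (ract_mul XP).
Qed.

Lemma contract2_lact u v a z : contract2 u v (a *> z) = contract2 u (v <* a) z.
Proof.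
rewrite [_ *> _]/= [LHS](tfold_comp _ _ (contract2D u v)).
by apply: eq_tfold => w1 w2; rewrite contract2_mk.
Qed.

Lemma contract2_scale u v (c : k) z : contract2 u v (c%:A *> z) = c *: contract2 u v z.
Proof.
rewrite contract2_lact -(lract_base XP) /contract2 /tensA_fold /tfold /fsum scaler_sumr.
apply: eq_bigr => -[w1 w2] _ /=; have [_ w1Z] := dualP (w1 : dualElt X).
by rewrite w1Z -scalerAl mul1r (linZ (form_ractr_lin _ _)).
Qed.

Lemma contract2_bilin u v z : bilin (fun g h : H => contract2 (g ▷ u) (h ▷ v) z).
Proof.
split=> [h|g]; apply: tfold_linear => w1 w2; first exact: form_ractl_lin.
by move=> c x y; rewrite form_hact_lin form_ractr_lin.
Qed.

Lemma contract2_braid u v z :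
  contract2 u v (braid z) = \ksum_(x, y <- Rb) contract2 (x ▷ v) (y ▷ u) z.
Proof.
rewrite [LHS](tfold_comp _ _ (contract2D u v)).
rewrite [RHS]kfold_tfold_exch; apply: eq_tfold => w1 w2.
rewrite (kfold_comp _ _ (contract2D u v)) -braid_pairing.
by apply: eq_kfold => x y; rewrite contract2_mk.
Qed.

Lemma contract2_swap_ract u v a z :
  \ksum_(x, y <- Rb) contract2 (x ▷ v) ((y ▷ u) <* a) z
  = \ksum_(x, y <- Rb) contract2 (x ▷ (v <* a)) (y ▷ u) z.
Proof.
rewrite [LHS]kfold_tfold_exch [RHS]kfold_tfold_exch; apply: eq_tfold => w1 w2.
exact: swap_ract.
Qed.

Lemma contract2_antisym u v z :
  contract2 u v (antisym2 z)
  = 2^-1 *: (contract2 u v z - \ksum_(x, y <- Rb) contract2 (x ▷ v) (y ▷ u) z).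
Proof. by rewrite contract2_scale -contract2_braid contract2D contract2N. Qed.

Definition braid_antisymmetric z : Prop :=
  forall u v, \ksum_(x, y <- Rb) contract2 (x ▷ v) (y ▷ u) z = - contract2 u v z.

Lemma antisym2_antisymmetric z : braid_antisymmetric (antisym2 z).
Proof.
move=> u v; rewrite contract2_antisym -scalerN opprB.
under eq_kfold_in do rewrite contract2_antisym.
rewrite -kfold_scale_out kfold_addf kfold_oppf.
by rewrite (univRV_swapK (F := fun u v => contract2 u v z)) //; exact: contract2_bilin.
Qed.

Lemma wedge_antisymmetric w1 w2 : braid_antisymmetric (wedge w1 w2).
Proof.
move=> u v; rewrite contract2_scale -scalerN -antisym2_antisymmetric.
under eq_kfold_in do rewrite contract2_scale.
by rewrite -kfold_scale_out.
Qed.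

Lemma one_form_span (P : Omega -> Prop) :
  P 0 -> (forall w w', P w -> P w' -> P (w + w')) ->
  (forall a b, P (a *> exd0 b)) -> forall w, P w.
Proof.
move=> P0 PD Pg w; have /asboolP[s hs] := oneFormP w.
have -> : w = \sum_(p <- s) (p.1 *> exd0 p.2).
  apply: val_inj; apply: (etrans hs); apply/esym.
  exact: (big_morph (@oneForm_val k H A) (fun _ _ => erefl) erefl).
by elim/big_ind: _.
Qed.

Section TwoInvertible.
Hypothesis unit2 : (2 : k) \is a GRing.unit.

Lemma contract2_wedge u v w1 w2 :
  contract2 u v (wedge w1 w2) = (w2 : dualElt X) (u <* (w1 : dualElt X) v)
    - \ksum_(x, y <- Rb) (w2 : dualElt X) ((x ▷ v) <* (w1 : dualElt X) (y ▷ u)).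
Proof.
rewrite contract2_scale contract2_antisym scalerA mulr1 divr1 divrr // scale1r.
rewrite contract2_mk; congr (_ - _); apply: eq_kfold => x y; exact: contract2_mk.
Qed.

Lemma contract2_wedge_ract u v a w1 w2 :
  contract2 u (v <* a) (wedge w1 w2) = (w2 : dualElt X) (u <* (w1 : dualElt X) (v <* a))
    - \ksum_(x, y <- Rb) (w2 : dualElt X) ((x ▷ v) <* (w1 : dualElt X) ((y ▷ u) <* a)).
Proof. by rewrite contract2_wedge swap_ract. Qed.

Variables (d : Omega -> tensA Omega Omega) (hd : exterior_derivative d).

(** Both sides are additive in [w], and [d (a db) = da ∧ db]. The signs are
    opposite to the usual ones, since the pairing with [u ⊗ v] feeds [v], not
    [u], to the first factor. *)
Lemma cartan_formula u v w :
  contract2 u v (d w) = - u ((w : dualElt X) v)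
    + \ksum_(x, y <- Rb) (x ▷ v : X) ((w : dualElt X) (y ▷ u))
    + (w : dualElt X) (vf_bracket u v : X).
Proof.
have [[dD _] _ _ dd dl _] := hd.
have vfD (t : X) : {morph t : a b / a + b} := linD (vf_lin t).
move: w; apply: one_form_span => [|w w' hw hw'|a b].
- have -> : d 0 = 0 by apply: (addrI (d 0)); rewrite -dD !addr0.
  rewrite contract2_0 (lin0 (vf_lin u)) oppr0 add0r addr0 /kfold /tfold /fsum big1 //.
  by move=> p _; rewrite (lin0 (vf_lin _)).
- rewrite dD contract2D hw hw' addrACA; congr (_ + _).
  rewrite addrACA -opprD -vfD -kfold_addf; congr (_ + _).
  by apply: eq_kfold => x y; rewrite -vfD.
- by rewrite dl contract2D dd contract2_lact contract2_0 addr0 contract2_wedge cartan_exact.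
Qed.

(** The scalar is moved inside the derivative, [a *> d w = d (a *> w) - da ∧ w],
    so that no vector field of the form [u, v <* a] enters a bracket. *)
Lemma contract2_exd_ract u v a w :
  contract2 u (v <* a) (d w) = - u ((w : dualElt X) (v <* a))
    + \ksum_(x, y <- Rb) (x ▷ v : X) ((w : dualElt X) ((y ▷ u) <* a))
    + (w : dualElt X) ((vf_bracket u v : X) <* a)
    - ((w : dualElt X) (u <* v a)
       - \ksum_(x, y <- Rb) (w : dualElt X) ((x ▷ v) <* (y ▷ u : X) a)).
Proof.
rewrite -contract2_lact -[X in contract2 u v X](addKr (wedge (exd0 a) w)) -(exd_leibnizl hd).
by rewrite contract2D cartan_formula addrC contract2N contract2_wedge.
Qed.

End TwoInvertible.
End Contraction.

(** * Contraction with a section of the module *)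

Section ModuleContraction.
Variables (k : comUnitRingType) (H : triangularHopfAlgType k) (A : braidedComAlgType H).
Variable Gamma : equivBimod A.
Local Notation Rb := (univRV : ktens H H).
Local Notation X := (vectorFields A).
Local Notation XP := (equivBimodP X).
Local Notation Omega := (oneForms A).
Local Notation Gamma' := (dual Gamma).
Implicit Types (u v : X) (s : Gamma) (sigma : Gamma') (t : tensA Gamma' (tensA Omega Omega)).

Definition contract3 u v s t : A :=
  \tsum_(sigma, z <- t) contract2 u (v <* pairing s sigma) z.

Lemma contract3_balanced u v s :
  balanced (@ract _ _ _ Gamma') (@lact _ _ _ (tensA Omega Omega))
    (fun sigma z => contract2 u (v <* pairing s sigma) z).
Proof.
split=> [z sigma sigma'|sigma z z'|sigma a z].
- by rewrite -contract2_addr -(ract_addr XP).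
- exact: contract2D.
- by rewrite contract2_lact -(ract_mul XP).
Qed.

Lemma contract3_mk u v s sigma (z : tensA Omega Omega) :
  contract3 u v s (sigma ⊗A z) = contract2 u (v <* pairing s sigma) z.
Proof. exact: tfold_tmk (contract3_balanced u v s). Qed.

Lemma contract3D u v s : {morph contract3 u v s : t t' / t + t'}.
Proof. exact: tfoldD (contract3_balanced u v s). Qed.

Lemma contract3_vf_balanced s t :
  balanced (@ract _ _ _ X) (@lact _ _ _ X) (fun u v => contract3 u v s t).
Proof.
split=> [v u u'|u v v'|u a v].
- by rewrite -[RHS]tfold_addf; apply: eq_tfold => sigma z; apply: contract2_addl.
- rewrite -[RHS]tfold_addf; apply: eq_tfold => sigma z.
  by rewrite (ract_addl XP) contract2_addr.
- apply: eq_tfold => sigma z.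
  by rewrite contract2_middle (lract_assoc XP).
Qed.

Lemma pairing3_mk (uv : tensA X X) s t :
  pairing3 (uv ⊗A s) t = \tsum_(u, v <- uv) contract3 u v s t.
Proof.
have hb := contract3_vf_balanced ^~ t.
apply: (tfold_tmk (f := fun (uv : tensA X X) s => \tsum_(u, v <- uv) contract3 u v s t)).
split=> [r p p'|p r r'|p a r].
- exact: (tfoldD (hb r)).
- rewrite -[RHS]tfold_addf; apply: eq_tfold => u v.
  rewrite -[RHS]tfold_addf; apply: eq_tfold => sigma z.
  have [sigmaD _] := dualP sigma.
  by rewrite -contract2_addr -(ract_addr XP) [in LHS]/pairing sigmaD.
- rewrite [LHS](tfold_comp _ _ (tfoldD (hb r))); apply: eq_tfold => u v.
  rewrite [LHS](tfold_tmk _ _ (hb r)); apply: eq_tfold => sigma z.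
  have [_ sigmaZ] := dualP sigma.
  by rewrite [in RHS]/pairing sigmaZ (ract_mul XP).
Qed.

Lemma pairing3_pure u v s t :
  pairing3 ((u ⊗A v : tensA _ _) ⊗A s) t = contract3 u v s t.
Proof. by rewrite pairing3_mk; exact: tfold_tmk (contract3_vf_balanced s t). Qed.

Lemma pairing3_wedge u v s t :
  pairing3 (wedge_vf u v ⊗A s) t
  = contract3 u v s t - \ksum_(x, y <- Rb) contract3 (x ▷ v) (y ▷ u) s t.
Proof.
have hb := contract3_vf_balanced s t.
rewrite pairing3_mk /tensA_fold (tfoldD hb) (tfold_opp _ hb) (tfold_tmk _ _ hb).
congr (_ - _); rewrite (kfold_comp _ _ (tfoldD hb)).
by apply: eq_kfold => x y; exact: tfold_tmk hb.
Qed.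

End ModuleContraction.

(** * Curvature and the square of the dual exterior derivative *)

Section StructureEquation.
Variables (k : comUnitRingType) (H : triangularHopfAlgType k) (A : braidedComAlgType H).
Variable Gamma : equivBimod A.
Local Notation Rb := (univRV : ktens H H).
Local Notation X := (vectorFields A).
Local Notation Omega := (oneForms A).
Local Notation Gamma' := (dual Gamma).
Implicit Types (u v : X) (s : Gamma) (sigma : Gamma').
Variables (d : Omega -> tensA Omega Omega) (hd : exterior_derivative d).
Variables (nabla : Gamma -> tensA Omega Gamma) (nabla' : Gamma' -> tensA Gamma' Omega).

Lemma contract3_sq u v s sigma :
  contract3 u v s (exd_connection_sq d nabla' sigma)
  = \tsum_(sigma1, w1 <- nabla' sigma)
      (\tsum_(sigma2, w2 <- nabla' sigma1) contract2 u (v <* pairing s sigma2) (wedge w2 w1)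
       + contract2 u (v <* pairing s sigma1) (d w1)).
Proof.
rewrite [LHS](tfold_comp _ _ (contract3D u v s)); apply: eq_tfold => sigma1 w1.
rewrite contract3D contract3_mk; congr (_ + _).
rewrite [LHS](tfold_comp _ _ (contract3D u v s)); apply: eq_tfold => sigma2 w2.
exact: contract3_mk.
Qed.

(** The components of the square in the forms are wedge products and values of
    [d], hence antisymmetrized tensors. *)
Lemma contract3_sq_antisym u v s sigma :
  \ksum_(x, y <- Rb) contract3 (x ▷ v) (y ▷ u) s (exd_connection_sq d nabla' sigma)
  = - contract3 u v s (exd_connection_sq d nabla' sigma).
Proof.
have swap a z : braid_antisymmetric z ->
    \ksum_(x, y <- Rb) contract2 (x ▷ v) ((y ▷ u) <* a) z = - contract2 u (v <* a) z.
  by move=> hz; rewrite contract2_swap_ract hz.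
under eq_kfold_in do rewrite contract3_sq.
rewrite contract3_sq [LHS]kfold_tfold_exch -[RHS]tfold_oppf; apply: eq_tfold => sigma1 w1.
rewrite opprD kfold_addf; congr (_ + _).
  rewrite [LHS]kfold_tfold_exch -[RHS]tfold_oppf; apply: eq_tfold => sigma2 w2.
  by apply: swap; apply: wedge_antisymmetric.
by apply: swap; have [t ->] := exd_two_form hd w1; apply: antisym2_antisymmetric.
Qed.

Hypothesis hnabla' : dual_connection nabla nabla'.

Lemma pairing_covariant u s sigma :
  pairing (covariant nabla u s) sigma
  = u (pairing s sigma)
    - \tsum_(sigma1, w1 <- nabla' sigma) (w1 : dualElt X) (u <* pairing s sigma1).
Proof.
have evalD : {morph (fun w : Omega => (w : dualElt X) u) : w w' / w + w'} by [].
have := congr1 (fun w : Omega => (w : dualElt X) u) (hnabla' s sigma).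
rewrite evalD /pairing_l /pairing_r /tensA_fold !(tfold_comp _ _ evalD).
have [sigmaD sigmaZ] := dualP sigma.
move=> /= e; rewrite [LHS](tfold_comp _ _ sigmaD).
rewrite -[u (pairing s sigma)]/((exd0 (pairing s sigma) : dualElt X) u) [exd0 _ u]e addrK.
by apply: eq_tfold => w s'; rewrite sigmaZ.
Qed.

(** The contribution of a summand [sigma1 ⊗ w1] of [nabla' sigma] to
    [u (v (sigma s)) - sigma (nabla_u nabla_v s)]. *)
Definition covariant2_summand u v s (sigma1 : Gamma') (w1 : Omega) : A :=
  u ((w1 : dualElt X) (v <* pairing s sigma1))
  + (w1 : dualElt X) (u <* v (pairing s sigma1))
  - \tsum_(sigma2, w2 <- nabla' sigma1)
      (w1 : dualElt X) (u <* (w2 : dualElt X) (v <* pairing s sigma2)).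

Lemma pairing_covariant2 u v s sigma :
  pairing (covariant nabla u (covariant nabla v s)) sigma
  = u (v (pairing s sigma))
    - \tsum_(sigma1, w1 <- nabla' sigma) covariant2_summand u v s sigma1 w1.
Proof.
have uD : {morph u : a b / a + b} := linD (vf_lin u).
have uN a : u (- a) = - u a by apply: (addIr (u a)); rewrite -uD !addNr (lin0 (vf_lin u)).
rewrite !pairing_covariant uD uN -addrA -opprD (tfold_comp _ _ uD) -tfold_addf.
congr (_ - _); apply: eq_tfold => sigma1 w1.
rewrite /covariant2_summand -addrA; congr (_ + _).
have wL := form_ractr_lin (w1 : dualElt X) u.
rewrite pairing_covariant (linD wL) -scaleN1r (linZ wL) scaleN1r.
by rewrite [X in _ - X](tfold_comp _ _ (linD wL)).
Qed.

(** In [sigma (R (u, v, s))] the terms that differentiate [sigma s] twice cancel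
    by the definition of the bracket; the rest agrees with the contraction of
    the square already for each summand [sigma1 ⊗ w1] of [nabla' sigma]. *)
Lemma pairing_curvature u v s sigma : (2 : k) \is a GRing.unit ->
  pairing (curvature nabla u v s) sigma = contract3 u v s (exd_connection_sq d nabla' sigma).
Proof.
move=> unit2; have [sigmaD _] := dualP sigma.
rewrite /pairing /curvature !sigmaD !formN -![sigma _]/(pairing _ sigma).
rewrite [pairing (kfold _ _) _](kfold_comp _ _ sigmaD).
under eq_kfold_in do rewrite -[sigma _]/(pairing _ sigma) pairing_covariant2.
rewrite pairing_covariant2 pairing_covariant contract3_sq.
rewrite kfold_addf kfold_oppf kfold_tfold_exch.
have cancel_second_order (p q r r' t : A) : p - q - (r - r') - (p - r - t) = r' - q + t.
  rewrite (opprB r) [r' - r]addrC addrACA (opprB _ t) [X in X + _]addrC.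
  by rewrite (addrACA (- q + r')) subrr addr0 [- q + r']addrC.
rewrite [LHS]cancel_second_order /tensA_fold -tfold_oppf -!tfold_addf.
apply: eq_tfold => sigma1 w1.
rewrite contract2_exd_ract //.
under [X in _ = X + _]eq_tfold do rewrite contract2_wedge_ract //.
rewrite tfold_addf tfold_oppf -kfold_tfold_exch.
rewrite {2}/covariant2_summand.
under eq_kfold_in do rewrite /covariant2_summand.
rewrite !kfold_addf kfold_oppf.
by rewrite !opprD !opprK !addrA [LHS](ACl (6*3*4*1*7*5*2)).
Qed.

End StructureEquation.

Theorem theorem5p7 (k : comUnitRingType) (hk : base_ring k)
    (H : triangularHopfAlgType k) (A : braidedComAlgType H)
    (Gamma : equivBimod A) (hGamma : symmetric_bimod Gamma)
    (hX : fg_projective (vectorFields A)) (hOmega : fg_projective (oneForms A))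
    (hGammafgp : fg_projective Gamma)
    (d : oneForms A -> tensA (oneForms A) (oneForms A)) (hd : exterior_derivative d)
    (nabla : Gamma -> tensA (oneForms A) Gamma) (hnabla : left_connection nabla)
    (nabla' : dual Gamma -> tensA (dual Gamma) (oneForms A))
    (hnabla' : dual_connection nabla nabla')
    (u v : vectorFields A) (s : Gamma) (sigma : dual Gamma) :
  pairing (curvature nabla u v s) sigma
    = pairing3 ((u ⊗A v : tensA _ _) ⊗A s) (exd_connection_sq d nabla' sigma)
  /\ pairing (curvature nabla u v s) sigma
    = 2^-1 *: pairing3 (wedge_vf u v ⊗A s) (exd_connection_sq d nabla' sigma).
Proof.
have unit2 := base_ring_unit2 hk.
rewrite pairing3_pure pairing3_wedge contract3_sq_antisym // opprK.
rewrite -(pairing_curvature hd hnabla') //; split=> //.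
by rewrite -mulr2n -scaler_nat scalerA mulVr // scale1r.
Qed.
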